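(* Let $Y$ be a shift-invariant subspace of $\mathcal B_0$. Then the closure of $Y$ in $\mathcal B_0$ (with respect to $\|\cdot\|_{\mathcal B}$) equals $\mathcal B_0\cap\overline{Y}^{H^\infty}$, where $\overline Y^{H^\infty}$ is the closure of $Y$ in $H^\infty(\mathbb C_+)$ with the sup norm. Likewise, if $Z$ is a shift-invariant subspace of $\mathcal B$ containing the constant functions, then the closure of $Z$ in $\mathcal B$ equals $\mathcal B\cap\overline Z^{H^\infty}$.
   Context: $\mathbb C_+=\{z:\Re z>0\}$. $\mathcal B$ is the space of holomorphic $f$ on $\mathbb C_+$ with $\|f\|_{\mathcal B_0}:=\int_0^\infty\sup_{\beta\in\mathbb R}|f'(\alpha+i\beta)|\,d\alpha<\infty$; such $f$ are bounded, $f(\infty):=\lim_{\Re z\to\infty}f(z)$ exists; $\mathcal B$ is a Banach algebra with norm $\|f\|_{\mathcal B}=\|f\|_\infty+\|f\|_{\mathcal B_0}$, and $\mathcal B_0=\{f\in\mathcal B:f(\infty)=0\}$. A subspace $Y$ of $\mathcal B$ is shift-invariant if $T(a)Y\subset Y$ for all $a\ge0$, where $(T(a)f)(z)=f(z+a)$. *)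

(* Defs.v *)
From Stdlib Require Import Reals.
Open Scope R_scope.

Definition Cx : Type := (R * R)%type.
Definition Re (z : Cx) : R := fst z.
Definition Im (z : Cx) : R := snd z.
Definition Cmk (a b : R) : Cx := (a, b).
Definition RtoC (a : R) : Cx := (a, 0).
Definition C0 : Cx := (0, 0).
Definition Cadd (z w : Cx) : Cx := (Re z + Re w, Im z + Im w).
Definition Copp (z : Cx) : Cx := (- Re z, - Im z).
Definition Csub (z w : Cx) : Cx := Cadd z (Copp w).
Definition Cmul (z w : Cx) : Cx :=
  (Re z * Re w - Im z * Im w, Re z * Im w + Im z * Re w).
Definition Cmod (z : Cx) : R := sqrt (Re z * Re z + Im z * Im z).

Definition in_Cplus (z : Cx) : Prop := 0 < Re z.

Definition has_cderiv (f : Cx -> Cx) (z l : Cx) : Prop :=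
  forall eps, 0 < eps -> exists delta, 0 < delta /\
    forall h : Cx, h <> C0 -> Cmod h < delta ->
      Cmod (Csub (Csub (f (Cadd z h)) (f z)) (Cmul l h)) <= eps * Cmod h.

Definition is_deriv_on_Cplus (f df : Cx -> Cx) : Prop :=
  forall z, in_Cplus z -> has_cderiv f z (df z).

(** [step_below df x s n] : the step function equal to [s i] on
    [x i, x (i+1)] (i = 0..n), with 0 < x 0 <= x 1 <= ... , lies below
    g(alpha) := sup_beta |df(alpha + i beta)| (possibly +infinity). *)
Definition step_below (df : Cx -> Cx) (x s : nat -> R) (n : nat) : Prop :=
  0 < x O /\
  (forall i, (i <= n)%nat -> x i <= x (S i)) /\
  (forall i, (i <= n)%nat -> forall alpha, x i <= alpha <= x (S i) ->
     forall t, t < s i -> exists beta, t < Cmod (df (Cmk alpha beta))).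

Definition step_integral (x s : nat -> R) (n : nat) : R :=
  sum_f_R0 (fun i => s i * (x (S i) - x i)) n.

(** int_0^infty sup_beta |df(alpha+i beta)| d alpha <= b
    (lower integral: supremum of integrals of step functions below,
     which is the Lebesgue integral here since the integrand is l.s.c.) *)
Definition B0_seminorm_le (df : Cx -> Cx) (b : R) : Prop :=
  forall x s n, step_below df x s n -> step_integral x s n <= b.

Definition in_B (f : Cx -> Cx) : Prop :=
  exists df, is_deriv_on_Cplus f df /\ exists b, B0_seminorm_le df b.

Definition vanishes_at_infty (f : Cx -> Cx) : Prop :=
  forall eps, 0 < eps -> exists M, forall z, M < Re z -> Cmod (f z) < eps.

Definition in_B0 (f : Cx -> Cx) : Prop := in_B f /\ vanishes_at_infty f.

Definition sup_norm_le (f : Cx -> Cx) (a : R) : Prop :=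
  forall z, in_Cplus z -> Cmod (f z) <= a.

Definition B_norm_le (f : Cx -> Cx) (c : R) : Prop :=
  exists df a b, is_deriv_on_Cplus f df /\ sup_norm_le f a /\
    B0_seminorm_le df b /\ a + b <= c.

Definition Fsub (f g : Cx -> Cx) : Cx -> Cx := fun z => Csub (f z) (g z).

Definition B_closure (Y : (Cx -> Cx) -> Prop) (f : Cx -> Cx) : Prop :=
  forall eps, 0 < eps -> exists y, Y y /\ B_norm_le (Fsub f y) eps.

Definition Hinf_closure (Y : (Cx -> Cx) -> Prop) (f : Cx -> Cx) : Prop :=
  forall eps, 0 < eps -> exists y, Y y /\ sup_norm_le (Fsub f y) eps.

Definition is_subspace (Y : (Cx -> Cx) -> Prop) : Prop :=
  Y (fun _ => C0) /\
  (forall f g, Y f -> Y g -> Y (fun z => Cadd (f z) (g z))) /\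
  (forall (c : Cx) f, Y f -> Y (fun z => Cmul c (f z))).

Definition shift (a : R) (f : Cx -> Cx) : Cx -> Cx := fun z => f (Cadd z (RtoC a)).

Definition shift_invariant (Y : (Cx -> Cx) -> Prop) : Prop :=
  forall a f, 0 <= a -> Y f -> Y (shift a f).

(* Main.v *)
Require Import Defs.
From Stdlib Require Import Reals Lra Lia Classical IndefiniteDescription.
From Coquelicot Require Import Coquelicot.
Open Scope R_scope.

(** Write [T(a)] for the shift by [a]. If [h] is holomorphic with [|h| <= M] on the half-plane,
    Cauchy's formula gives [|h'(z)| <= 8 M / x] and [|h'(z + d) - h'(z)| <= 64 M d / x^2]
    where [x = Re z]. The second bound is integrable at infinity, so for [0 < a <= c] the
    operator [T(a) - T(c)] is bounded from H^oo to B, although a single shift is not.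
    For [f] in B with limit [l] at infinity and [y] close to [f] in sup norm, split
    [f - l - (T(a) y - T(c) y) = (f - T(a) f) + (T(c) f - l) + (T(a) - T(c)) (f - y)].
    In the B-norm the first term is small for small [a], the second for large [c], and then
    the third when [f - y] is small enough. Since [T(a) y - T(c) y + l] stays in the subspace,
    uniform approximation implies approximation in B.

    The function [g(x) = sup_y |f'(x + i y)|] is locally Lipschitz by the same bounds, so the
    lower integral defining the seminorm is a limit of Riemann integrals of [g]. *)

(** * Bisection of rectangles *)

(** Membership in B, as encoded, provides a pointwise complex derivative and a finite lower
    integral, but no continuity of [f'], no bound on [f] and no limit at infinity. Regularity
    therefore starts from Goursat's theorem, and the decay of [f'] and the limit are derived from
    the seminorm. Contours are squares, so that only real Riemann integrals over segments occur; on
    a square of half-side [x / 2] the estimates [4 M / r] and [16 M d / r^2] become the bounds with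
    8 and 64, which are not optimised. For [f - T(a) f] the bound [64 M a / t^2] is useless near
    [t = 0]. There the term is controlled instead by the smallness of the integral of [g] over short
    intervals at 0; the smallness over intervals far out controls [T(c) f - l]. The operator
    [T(a) - T(c)] has seminorm bound [64 (c - a) / a] relative to the sup norm, which blows up as
    [a] tends to 0 or [c] to infinity. Hence [a] and [c] are fixed from [f] alone, and only
    afterwards the accuracy required of [y]. *)

Lemma pow2_inv_small (K d : R) : 0 < d -> exists n, K / 2 ^ n < d.
Proof.
  intros Hd.
  destruct (INR_archimed d K Hd) as [n Hn].
  exists n.
  assert (Hp : 0 < 2 ^ n) by (apply pow_lt; lra).
  assert (Hq : INR n <= 2 ^ n).
  { clear. induction n as [|n IH]; [simpl; lra|].
    rewrite S_INR, <- tech_pow_Rmult.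
    assert (1 <= 2 ^ n) by (apply pow_R1_Rle; lra). lra. }
  apply (Rmult_lt_reg_r (2 ^ n)); [easy|].
  unfold Rdiv. rewrite Rmult_assoc, Rinv_l by lra. nra.
Qed.

(** The point is the supremum of the left ends: the right ends [x n + w / 2 ^ n] decrease, so each
    of them bounds every left end. *)
Lemma nested_dyadic_point (x : nat -> R) (w : R) :
  0 <= w ->
  (forall n, x n <= x (S n) <= x n + w / 2 ^ S n) ->
  exists p, forall n, x n <= p <= x n + w / 2 ^ n.
Proof.
  intros Hw Hx.
  assert (Hhalf : forall n, w / 2 ^ S n + w / 2 ^ S n = w / 2 ^ n).
  { intros n. rewrite <- tech_pow_Rmult. field. apply pow_nonzero; lra. }
  assert (Hpos : forall n, 0 <= w / 2 ^ n).
  { intros n. apply Rdiv_le_0_compat; [easy|apply pow_lt; lra]. }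
  assert (Hup : forall n k, x n <= x (n + k)%nat /\
     x (n + k)%nat + w / 2 ^ (n + k) <= x n + w / 2 ^ n).
  { intros n k. induction k as [|k IH].
    - rewrite Nat.add_0_r. lra.
    - rewrite Nat.add_succ_r. specialize (Hx (n + k)%nat).
      specialize (Hhalf (n + k)%nat). lra. }
  assert (Hxn : forall n m, x n <= x m + w / 2 ^ m).
  { intros n m. destruct (Nat.le_ge_cases n m) as [H|H].
    - destruct (Hup n (m - n)%nat) as [H1 _].
      replace (n + (m - n))%nat with m in H1 by lia. specialize (Hpos m). lra.
    - destruct (Hup m (n - m)%nat) as [_ H1].
      replace (m + (n - m))%nat with n in H1 by lia. specialize (Hpos n). lra. }
  destruct (completeness (fun t => exists n, t = x n)) as [p [Hp1 Hp2]].
  - exists (x O + w / 2 ^ 0). intros t [n ->]. apply Hxn.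
  - exists (x O), O. reflexivity.
  - exists p. intros n. split.
    + apply Hp1. now exists n.
    + apply Hp2. intros t [m ->]. apply Hxn.
Qed.

(** Compactness of a rectangle in the form needed both for Goursat's theorem and for local
    boundedness. If [P] failed, some quarter would fail as well, and repeated halving would give bad
    rectangles shrinking to a point, against the local hypothesis at that point. A rectangle is
    given by its lower left corner and its side lengths. *)
Lemma rectangle_bisection (P : R -> R -> R -> R -> Prop) (x y w h : R) :
  0 <= w -> 0 <= h ->
  (forall x y w h, 0 <= w -> 0 <= h ->
     P x y w h -> P (x + w) y w h -> P x (y + h) w h -> P (x + w) (y + h) w h ->
     P x y (w + w) (h + h)) ->
  (forall p q, x <= p <= x + w -> y <= q <= y + h ->
     exists d, 0 < d /\ forall x' y' w' h', 0 <= w' < d -> 0 <= h' < d ->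
       x' <= p <= x' + w' -> y' <= q <= y' + h' -> P x' y' w' h') ->
  P x y w h.
Proof.
  intros Hw Hh Hglue Hloc. apply NNPP. intros Hbad.
  assert (Hhalf : forall w n, w / 2 ^ S n + w / 2 ^ S n = w / 2 ^ n).
  { intros w' n. rewrite <- tech_pow_Rmult. field. apply pow_nonzero; lra. }
  assert (Hpos : forall w n, 0 <= w -> 0 <= w / 2 ^ n).
  { intros w' n Hw'. apply Rdiv_le_0_compat; [easy|apply pow_lt; lra]. }
  (* Badness is passed on by an implication, so a next corner exists for every index and corner,
     good or bad, and plain functional choice yields the sequence. *)
  assert (Hstep : forall ns : nat * (R * R), exists s' : R * R,
    let n := fst ns in let s := snd ns in
    (fst s <= fst s' <= fst s + w / 2 ^ S n) /\
    (snd s <= snd s' <= snd s + h / 2 ^ S n) /\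
    (~ P (fst s) (snd s) (w / 2 ^ n) (h / 2 ^ n) ->
     ~ P (fst s') (snd s') (w / 2 ^ S n) (h / 2 ^ S n))).
  { intros [n [s t]]; cbn -[pow].
    pose proof (Hpos w (S n) Hw) as Hw'. pose proof (Hpos h (S n) Hh) as Hh'.
    rewrite <- (Hhalf w n), <- (Hhalf h n).
    set (w' := w / 2 ^ S n) in *. set (h' := h / 2 ^ S n) in *.
    destruct (classic (P s t w' h')) as [H1|H1];
      [|exists (s, t); simpl; repeat split; try lra; tauto].
    destruct (classic (P (s + w') t w' h')) as [H2|H2];
      [|exists (s + w', t); simpl; repeat split; try lra; tauto].
    destruct (classic (P s (t + h') w' h')) as [H3|H3];
      [|exists (s, t + h'); simpl; repeat split; try lra; tauto].
    destruct (classic (P (s + w') (t + h') w' h')) as [H4|H4];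
      [|exists (s + w', t + h'); simpl; repeat split; try lra; tauto].
    exists (s, t); simpl; repeat split; try lra.
    intros H. destruct H. now apply Hglue. }
  apply functional_choice in Hstep. destruct Hstep as [f Hf].
  pose (u := fix u n := match n with O => (x, y) | S n => f (n, u n) end).
  assert (Hu : forall n, ~ P (fst (u n)) (snd (u n)) (w / 2 ^ n) (h / 2 ^ n)).
  { induction n as [|n IH].
    - simpl. now rewrite !Rdiv_1_r.
    - now apply (Hf (n, u n)). }
  destruct (nested_dyadic_point (fun n => fst (u n)) w Hw) as [p Hp].
  { intros n. apply (Hf (n, u n)). }
  destruct (nested_dyadic_point (fun n => snd (u n)) h Hh) as [q Hq].
  { intros n. apply (Hf (n, u n)). }
  destruct (Hloc p q) as [d [Hd HP]].
  { specialize (Hp O). simpl in Hp. lra. }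
  { specialize (Hq O). simpl in Hq. lra. }
  destruct (pow2_inv_small (w + h) d Hd) as [n Hn].
  apply (Hu n). pose proof (Hpos w n Hw). pose proof (Hpos h n Hh).
  assert (w / 2 ^ n + h / 2 ^ n = (w + h) / 2 ^ n) by (unfold Rdiv; ring).
  apply HP; try lra; auto.
Qed.

(** * Complex derivatives *)

Local Open Scope C_scope.

Definition is_cderive (f : C -> C) (z l : C) : Prop :=
  forall eps, (0 < eps)%R -> exists d, (0 < d)%R /\ forall h, (Cmod h < d)%R ->
    (Cmod (f (z + h) - f z - l * h)%C <= eps * Cmod h)%R.

Lemma Defs_Cmod (z : Cx) : Defs.Cmod z = Cmod z.
Proof.
  unfold Defs.Cmod, Cmod, Defs.Re, Defs.Im. f_equal. ring.
Qed.

Lemma has_cderiv_iff (f : Cx -> Cx) (z l : Cx) :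
  has_cderiv f z l <-> is_cderive f z l.
Proof.
  split; intros H eps Heps; destruct (H eps Heps) as [d [Hd Hb]];
    exists d; (split; [easy|]).
  - intros h Hh. destruct (classic (h = C0)) as [->|Hn].
    + replace (Cmod C0) with (Cmod 0) by reflexivity. rewrite Cmod_0.
      replace (z + C0) with z by (unfold C0; destruct z; apply injective_projections; simpl; ring).
      replace (f z - f z - l * C0) with (RtoC 0)
        by (unfold C0; apply injective_projections; simpl; ring).
      rewrite Cmod_0. lra.
    + specialize (Hb h Hn). rewrite !Defs_Cmod in Hb. exact (Hb Hh).
  - intros h _ Hh. rewrite !Defs_Cmod in *. exact (Hb h Hh).
Qed.

Lemma Cmod_minus_sym (a b : C) : Cmod (a - b)%C = Cmod (b - a)%C.
Proof. rewrite <- Cmod_opp. f_equal. ring. Qed.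

Lemma Cmod_minus_le (a b : C) : (Cmod (a - b)%C <= Cmod a + Cmod b)%R.
Proof. rewrite <- (Cmod_opp b). apply Cmod_triangle. Qed.

Lemma fst_le_Cmod (z : C) : (Rabs (fst z) <= Cmod z)%R.
Proof. eapply Rle_trans; [apply Rmax_l|apply Rmax_Cmod]. Qed.

Lemma snd_le_Cmod (z : C) : (Rabs (snd z) <= Cmod z)%R.
Proof. eapply Rle_trans; [apply Rmax_r|apply Rmax_Cmod]. Qed.

Lemma Cmod_le_fst_snd (z : C) : (Cmod z <= Rabs (fst z) + Rabs (snd z))%R.
Proof.
  replace z with ((fst z, 0)%R + Ci * (snd z, 0)%R) at 1
    by (destruct z; apply injective_projections; simpl; ring).
  eapply Rle_trans; [apply Cmod_triangle|].
  rewrite Cmod_mult, Cmod_Ci.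
  change (Cmod (RtoC (fst z)) + 1 * Cmod (RtoC (snd z)) <= Rabs (fst z) + Rabs (snd z))%R.
  rewrite !Cmod_R. lra.
Qed.

Lemma is_cderive_continuous (f : C -> C) (z l : C) :
  is_cderive f z l ->
  forall eps, (0 < eps)%R -> exists d, (0 < d)%R /\ forall h, (Cmod h < d)%R ->
    (Cmod (f (z + h) - f z)%C < eps)%R.
Proof.
  intros H eps Heps. destruct (H 1 Rlt_0_1) as [d [Hd Hb]].
  pose proof (Cmod_ge_0 l) as Hl.
  exists (Rmin d (eps / (2 + Cmod l))). split.
  - apply Rmin_pos; [easy|]. apply Rdiv_lt_0_compat; lra.
  - intros h Hh.
    assert (H1 : (Cmod h < d)%R) by (eapply Rlt_le_trans; [exact Hh|apply Rmin_l]).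
    assert (H2 : (Cmod h < eps / (2 + Cmod l))%R)
      by (eapply Rlt_le_trans; [exact Hh|apply Rmin_r]).
    specialize (Hb h H1).
    replace (f (z + h) - f z) with ((f (z + h) - f z - l * h) + l * h) by ring.
    eapply Rle_lt_trans; [apply Cmod_triangle|]. rewrite Cmod_mult.
    apply (Rmult_lt_compat_r (2 + Cmod l)) in H2; [|lra].
    unfold Rdiv in H2. rewrite Rmult_assoc, Rinv_l, Rmult_1_r in H2 by lra.
    pose proof (Cmod_ge_0 h). lra.
Qed.

Lemma is_cderive_minus (f g : C -> C) (z l m : C) :
  is_cderive f z l -> is_cderive g z m -> is_cderive (fun t => f t - g t) z (l - m).
Proof.
  intros Hf Hg eps Heps.
  destruct (Hf (eps / 2)%R) as [d [Hd Hb]]; [lra|].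
  destruct (Hg (eps / 2)%R) as [d' [Hd' Hb']]; [lra|].
  exists (Rmin d d'). split; [now apply Rmin_pos|]. intros h Hh.
  specialize (Hb h (Rlt_le_trans _ _ _ Hh (Rmin_l _ _))).
  specialize (Hb' h (Rlt_le_trans _ _ _ Hh (Rmin_r _ _))).
  replace (f (z + h) - g (z + h) - (f z - g z) - (l - m) * h)
    with ((f (z + h) - f z - l * h) - (g (z + h) - g z - m * h)) by ring.
  eapply Rle_trans; [apply Cmod_minus_le|]. lra.
Qed.

Lemma is_cderive_shift (f : C -> C) (a z l : C) :
  is_cderive f (z + a) l -> is_cderive (fun t => f (t + a)) z l.
Proof.
  intros H eps Heps. destruct (H eps Heps) as [d [Hd Hb]]. exists d. split; [easy|].
  intros h Hh. replace (z + h + a) with (z + a + h) by ring. now apply Hb.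
Qed.

Lemma is_cderive_const (c z : C) : is_cderive (fun _ => c) z 0.
Proof.
  intros eps Heps. exists 1%R. split; [lra|]. intros h _.
  replace (c - c - 0 * h) with (RtoC 0) by ring. rewrite Cmod_0.
  pose proof (Cmod_ge_0 h). nra.
Qed.

Lemma is_cderive_mult (f g : C -> C) (z l m : C) :
  is_cderive f z l -> is_cderive g z m ->
  is_cderive (fun t => f t * g t) z (l * g z + f z * m).
Proof.
  intros Hf Hg eps Heps.
  (* The four error terms of the product expansion are at most [e * Cmod h] times 1, [Cmod m],
     [Cmod (g z)] and [Cmod (f z)]; [K] is the sum of these factors. *)
  set (K := (1 + Cmod (f z) + Cmod (g z) + Cmod m)%R).
  pose proof (Cmod_ge_0 (f z)). pose proof (Cmod_ge_0 (g z)). pose proof (Cmod_ge_0 m).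
  assert (HK : (1 <= K)%R) by (unfold K; lra).
  assert (He : (0 < eps / (4 * K))%R) by (apply Rdiv_lt_0_compat; lra).
  assert (HKe : (K * (eps / (4 * K)) = eps / 4)%R) by (field; lra).
  set (e := (eps / (4 * K))%R) in *.
  destruct (Hf e He) as [d1 [Hd1 Hb1]].
  destruct (Hg e He) as [d2 [Hd2 Hb2]].
  destruct (is_cderive_continuous f z l Hf (Rmin 1 e)) as [d3 [Hd3 Hb3]];
    [apply Rmin_pos; lra|].
  exists (Rmin (Rmin d1 d2) d3). split; [repeat apply Rmin_pos; easy|].
  intros h Hh.
  assert (Hh1 : (Cmod h < d1)%R).
  { eapply Rlt_le_trans; [exact Hh|]. eapply Rle_trans; apply Rmin_l. }
  assert (Hh2 : (Cmod h < d2)%R).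
  { eapply Rlt_le_trans; [exact Hh|]. eapply Rle_trans; [apply Rmin_l|apply Rmin_r]. }
  assert (Hh3 : (Cmod h < d3)%R).
  { eapply Rlt_le_trans; [exact Hh|]. apply Rmin_r. }
  specialize (Hb1 h Hh1). specialize (Hb2 h Hh2). specialize (Hb3 h Hh3).
  replace (f (z + h) * g (z + h) - f z * g z - (l * g z + f z * m) * h)
    with (((f (z + h) - f z) * (g (z + h) - g z - m * h)
            + (f (z + h) - f z) * (m * h))
          + ((f (z + h) - f z - l * h) * g z + f z * (g (z + h) - g z - m * h)))
    by ring.
  eapply Rle_trans; [apply Cmod_triangle|].
  eapply Rle_trans; [apply Rplus_le_compat; apply Cmod_triangle|].
  rewrite !Cmod_mult.
  pose proof (Rmin_l 1 e). pose proof (Rmin_r 1 e).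
  set (A := Cmod (f (z + h) - f z)%C) in *.
  set (B := Cmod (g (z + h) - g z - m * h)%C) in *.
  set (D := Cmod (f (z + h) - f z - l * h)%C) in *.
  assert (0 <= A)%R by apply Cmod_ge_0. assert (0 <= B)%R by apply Cmod_ge_0.
  assert (0 <= D)%R by apply Cmod_ge_0. pose proof (Cmod_ge_0 h).
  set (H' := Cmod h) in *.
  assert (A * B <= e * H')%R by nra.
  assert (A * (Cmod m * H') <= e * Cmod m * H')%R.
  { rewrite <- Rmult_assoc. apply Rmult_le_compat_r; [easy|]. nra. }
  assert (D * Cmod (g z) <= e * H' * Cmod (g z))%R by (apply Rmult_le_compat_r; lra).
  assert (Cmod (f z) * B <= Cmod (f z) * (e * H'))%R by (apply Rmult_le_compat_l; lra).
  assert (K * e * H' <= eps * H')%R by nra.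
  unfold K in *. nra.
Qed.

Lemma is_cderive_scal (c : C) (f : C -> C) (z l : C) :
  is_cderive f z l -> is_cderive (fun t => c * f t) z (c * l).
Proof.
  intros H. replace (c * l) with (0 * f z + c * l) by ring.
  apply (is_cderive_mult (fun _ => c) f); [apply is_cderive_const|easy].
Qed.

(** With [u = z - p] the remainder is exactly [h^2 / (u^2 (u + h))], and [Cmod h < Cmod u / 2] keeps
    [u + h] at least [Cmod u / 2] away from 0. *)
Lemma is_cderive_inv_sub (p z : C) :
  z <> p -> is_cderive (fun t => / (t - p)) z (- / ((z - p) * (z - p))).
Proof.
  intros Hz eps Heps.
  assert (Hn : z - p <> 0).
  { intros E. apply Hz. replace z with ((z - p) + p) by ring. rewrite E. ring. }
  set (u := z - p) in *. set (U := Cmod u).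
  assert (HU : (0 < U)%R) by now apply Cmod_gt_0.
  exists (Rmin (U / 2) (eps * (U * U * U) / 2)). split.
  { apply Rmin_pos; [lra|]. apply Rdiv_lt_0_compat; [|lra].
    repeat apply Rmult_lt_0_compat; easy. }
  intros h Hh.
  assert (H1 : (Cmod h < U / 2)%R) by (eapply Rlt_le_trans; [exact Hh|apply Rmin_l]).
  assert (H2 : (Cmod h < eps * (U * U * U) / 2)%R)
    by (eapply Rlt_le_trans; [exact Hh|apply Rmin_r]).
  assert (H3 : (U / 2 <= Cmod (u + h)%C)%R).
  { assert (U <= Cmod (u + h)%C + Cmod h)%R; [|lra].
    unfold U. replace u with ((u + h) - h) at 1 by ring. apply Cmod_minus_le. }
  assert (Hn' : u + h <> 0) by (apply Cmod_gt_0; lra).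
  replace (z + h - p) with (u + h) by (unfold u; ring).
  replace (/ (u + h) - / u - - / (u * u) * h) with (h * h * / (u * u * (u + h)))
    by (field; split; easy).
  rewrite !Cmod_mult, Cmod_inv, !Cmod_mult
    by (repeat apply Cmult_neq_0; easy).
  fold U. set (V := Cmod (u + h)%C) in *. pose proof (Cmod_ge_0 h).
  rewrite (Rmult_comm eps), Rmult_assoc. apply Rmult_le_compat_l; [easy|].
  assert (HV : (0 < U * U * V)%R) by (repeat apply Rmult_lt_0_compat; lra).
  apply (Rmult_le_reg_r (U * U * V)); [easy|].
  rewrite Rmult_assoc, Rinv_l, Rmult_1_r by lra.
  assert (0 < U * U)%R by nra. 
  assert (eps * (U * U) * (U / 2) <= eps * (U * U) * V)%R; [|nra].
  apply Rmult_le_compat_l; [nra|easy].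
Qed.

(** * Goursat's theorem and Cauchy's formula for the derivative *)

(** Here [gam] stands for a horizontal or vertical line and [phi] for a coordinate, both
    1-Lipschitz; this supplies the Riemann integrability on the sides of rectangles. *)
Lemma continuous_along (F : C -> C) (gam : R -> C) (phi : C -> R) (t0 : R) (l : C) :
  (forall t, Cmod (gam t - gam t0) <= Rabs (t - t0))%R ->
  (forall a b, Rabs (phi a - phi b) <= Cmod (a - b))%R ->
  is_cderive F (gam t0) l -> continuous (fun t => phi (F (gam t))) t0.
Proof.
  intros Hg Hphi HF. apply filterlim_locally. intros eps.
  destruct (is_cderive_continuous F _ l HF eps (cond_pos eps)) as [d [Hd Hb]].
  exists (mkposreal d Hd). intros t Ht. change (Rabs (t - t0) < d)%R in Ht.
  change (Rabs (phi (F (gam t)) - phi (F (gam t0))) < eps)%R.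
  eapply Rle_lt_trans; [apply Hphi|].
  replace (gam t) with (gam t0 + (gam t - gam t0)) by ring.
  apply Hb. eapply Rle_lt_trans; [apply Hg|exact Ht].
Qed.

Lemma fst_lipschitz (a b : C) : (Rabs (fst a - fst b) <= Cmod (a - b))%R.
Proof. apply (fst_le_Cmod (a - b)). Qed.

Lemma snd_lipschitz (a b : C) : (Rabs (snd a - snd b) <= Cmod (a - b))%R.
Proof. apply (snd_le_Cmod (a - b)). Qed.

Lemma Cmod_lipschitz (a b : C) : (Rabs (Cmod a - Cmod b) <= Cmod (a - b))%R.
Proof.
  pose proof (Cmod_triangle (a - b) b) as H1.
  pose proof (Cmod_triangle (b - a) a) as H2.
  rewrite (Cmod_minus_sym b a) in H2.
  replace (a - b + b) with a in H1 by ring.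
  replace (b - a + a) with b in H2 by ring.
  apply Rabs_le. lra.
Qed.

Lemma horizontal_lipschitz (c t t0 : R) :
  (Cmod ((t, c) - (t0, c))%C <= Rabs (t - t0))%R.
Proof.
  replace ((t, c) - (t0, c)) with (RtoC (t - t0))
    by (apply injective_projections; simpl; ring).
  rewrite Cmod_R. lra.
Qed.

Lemma vertical_lipschitz (c t t0 : R) :
  (Cmod ((c, t) - (c, t0))%C <= Rabs (t - t0))%R.
Proof.
  replace ((c, t) - (c, t0)) with (Ci * RtoC (t - t0))
    by (apply injective_projections; simpl; ring).
  rewrite Cmod_mult, Cmod_Ci, Cmod_R. lra.
Qed.

Lemma ex_RInt_horizontal (F : C -> C) (a b c : R) :
  (a <= b)%R -> (forall x, (a <= x <= b)%R -> exists l, is_cderive F (x, c) l) ->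
  ex_RInt (fun x => fst (F (x, c))) a b.
Proof.
  intros Hab HF. apply @ex_RInt_continuous. intros t Ht.
  rewrite Rmin_left, Rmax_right in Ht by easy. destruct (HF t Ht) as [l Hl].
  apply (continuous_along F (fun x => (x, c)) fst t l); [|apply fst_lipschitz|easy].
  intros s. apply horizontal_lipschitz.
Qed.

Lemma ex_RInt_vertical (F : C -> C) (a c d : R) :
  (c <= d)%R -> (forall y, (c <= y <= d)%R -> exists l, is_cderive F (a, y) l) ->
  ex_RInt (fun y => snd (F (a, y))) c d.
Proof.
  intros Hab HF. apply @ex_RInt_continuous. intros t Ht.
  rewrite Rmin_left, Rmax_right in Ht by easy. destruct (HF t Ht) as [l Hl].
  apply (continuous_along F (fun x => (a, x)) snd t l); [|apply snd_lipschitz|easy].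
  intros s. apply vertical_lipschitz.
Qed.

Lemma RInt_diff_near (f g m : R -> R) (a b I e : R) :
  (a <= b)%R -> ex_RInt f a b -> ex_RInt g a b -> is_RInt m a b I ->
  (forall t, a <= t <= b -> Rabs (f t - g t - m t) <= e)%R ->
  (Rabs (RInt f a b - RInt g a b - I) <= (b - a) * e)%R.
Proof.
  intros Hab Hf Hg Hm Hb.
  pose proof (is_RInt_minus _ _ _ _ _ _
    (is_RInt_minus _ _ _ _ _ _ (RInt_correct _ _ _ Hf) (RInt_correct _ _ _ Hg)) Hm) as H.
  pose proof (abs_RInt_le_const _ a b e Hab (ex_intro _ _ H) Hb) as K.
  apply is_RInt_unique in H. eapply Rle_trans; [|exact K].
  apply Req_le. f_equal. symmetry. exact H.
Qed.

(* The real part of the contour integral of [F dz] along the positively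
   oriented boundary of [a, b] x [c, d]. *)
Definition rect_int (F : C -> C) (a b c d : R) : R :=
  (RInt (fun x => fst (F (x, c))) a b - RInt (fun x => fst (F (x, d))) a b
   - (RInt (fun y => snd (F (b, y))) c d - RInt (fun y => snd (F (a, y))) c d))%R.

Definition cdiff_on (F : C -> C) (a b c d : R) : Prop :=
  forall x y, (a <= x <= b)%R -> (c <= y <= d)%R -> exists l, is_cderive F (x, y) l.

Definition cdiff_bd (F : C -> C) (a b c d : R) : Prop :=
  (forall x, (a <= x <= b)%R -> exists l, is_cderive F (x, c) l) /\
  (forall x, (a <= x <= b)%R -> exists l, is_cderive F (x, d) l) /\
  (forall y, (c <= y <= d)%R -> exists l, is_cderive F (a, y) l) /\
  (forall y, (c <= y <= d)%R -> exists l, is_cderive F (b, y) l).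

Lemma cdiff_on_bd (F : C -> C) (a b c d : R) :
  (a <= b)%R -> (c <= d)%R -> cdiff_on F a b c d -> cdiff_bd F a b c d.
Proof. intros Hab Hcd H. repeat split; intros t Ht; apply H; lra. Qed.

Lemma rect_int_split_x (F : C -> C) (a m b c d : R) :
  (a <= m <= b)%R ->
  (forall x, (a <= x <= b)%R -> exists l, is_cderive F (x, c) l) ->
  (forall x, (a <= x <= b)%R -> exists l, is_cderive F (x, d) l) ->
  rect_int F a b c d = (rect_int F a m c d + rect_int F m b c d)%R.
Proof.
  intros Hm Hc Hd. unfold rect_int.
  assert (forall y, (forall x, (a <= x <= b)%R -> exists l, is_cderive F (x, y) l) ->
    (RInt (fun x => fst (F (x, y))) a b
     = RInt (fun x => fst (F (x, y))) a m + RInt (fun x => fst (F (x, y))) m b)%R) as E.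
  { intros y Hy. symmetry.
    apply (RInt_Chasles (V := R_CompleteNormedModule));
      apply ex_RInt_horizontal; try lra; intros x Hx; apply Hy; lra. }
  rewrite (E c Hc), (E d Hd). ring.
Qed.

Lemma rect_int_split_y (F : C -> C) (a b c m d : R) :
  (c <= m <= d)%R ->
  (forall y, (c <= y <= d)%R -> exists l, is_cderive F (a, y) l) ->
  (forall y, (c <= y <= d)%R -> exists l, is_cderive F (b, y) l) ->
  rect_int F a b c d = (rect_int F a b c m + rect_int F a b m d)%R.
Proof.
  intros Hm Ha Hb. unfold rect_int.
  assert (forall x, (forall y, (c <= y <= d)%R -> exists l, is_cderive F (x, y) l) ->
    (RInt (fun y => snd (F (x, y))) c d
     = RInt (fun y => snd (F (x, y))) c m + RInt (fun y => snd (F (x, y))) m d)%R) as E.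
  { intros x Hx. symmetry.
    apply (RInt_Chasles (V := R_CompleteNormedModule));
      apply ex_RInt_vertical; try lra; intros y Hy; apply Hx; lra. }
  rewrite (E a Ha), (E b Hb). ring.
Qed.

(** Opposite sides are compared with each other, not one by one, because the models [m1] and [m2] of
    the differences are simple: zero for the crude bound, constants for an affine function, rational
    functions for the Cauchy kernel. *)
Lemma rect_int_near (F : C -> C) (m1 m2 : R -> R) (a b c d I1 I2 e : R) :
  (a <= b)%R -> (c <= d)%R -> cdiff_bd F a b c d ->
  is_RInt m1 a b I1 -> is_RInt m2 c d I2 ->
  (forall x, a <= x <= b -> Rabs (fst (F (x, c)) - fst (F (x, d)) - m1 x) <= e)%R ->
  (forall y, c <= y <= d -> Rabs (snd (F (b, y)) - snd (F (a, y)) - m2 y) <= e)%R ->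
  (Rabs (rect_int F a b c d - (I1 - I2)) <= (b - a + (d - c)) * e)%R.
Proof.
  intros Hab Hcd (Hc & Hd & Ha & Hb) Hm1 Hm2 H1 H2. unfold rect_int.
  pose proof (RInt_diff_near _ _ m1 a b I1 e Hab
    (ex_RInt_horizontal _ _ _ _ Hab Hc) (ex_RInt_horizontal _ _ _ _ Hab Hd) Hm1 H1) as E1.
  pose proof (RInt_diff_near _ _ m2 c d I2 e Hcd
    (ex_RInt_vertical _ _ _ _ Hcd Hb) (ex_RInt_vertical _ _ _ _ Hcd Ha) Hm2 H2) as E2.
  apply Rabs_le_between in E1. apply Rabs_le_between in E2. apply Rabs_le. lra.
Qed.

Lemma rect_int_bound (F : C -> C) (a b c d B : R) :
  (a <= b)%R -> (c <= d)%R -> cdiff_bd F a b c d ->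
  (forall x, a <= x <= b -> Cmod (F (x, c)) <= B /\ Cmod (F (x, d)) <= B)%R ->
  (forall y, c <= y <= d -> Cmod (F (a, y)) <= B /\ Cmod (F (b, y)) <= B)%R ->
  (Rabs (rect_int F a b c d) <= (b - a + (d - c)) * (2 * B))%R.
Proof.
  intros Hab Hcd HF H1 H2.
  replace (rect_int F a b c d)
    with (rect_int F a b c d - (scal (b - a) 0 - scal (d - c) 0))%R
    by (unfold scal; simpl; unfold mult; simpl; ring).
  apply rect_int_near with (fun _ => 0%R) (fun _ => 0%R); try easy;
    try apply @is_RInt_const.
  - intros x Hx. destruct (H1 x Hx) as [A1 A2].
    pose proof (fst_le_Cmod (F (x, c))) as B1. pose proof (fst_le_Cmod (F (x, d))) as B2.
    apply Rabs_le_between in B1, B2. apply Rabs_le. lra.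
  - intros x Hx. destruct (H2 x Hx) as [A1 A2].
    pose proof (snd_le_Cmod (F (a, x))) as B1. pose proof (snd_le_Cmod (F (b, x))) as B2.
    apply Rabs_le_between in B1, B2. apply Rabs_le. lra.
Qed.

Lemma Cmod_pair_sub_le (x y p q w h : R) :
  (Rabs (x - p) <= w -> Rabs (y - q) <= h -> Cmod ((x, y) - (p, q))%C <= w + h)%R.
Proof.
  intros H1 H2. eapply Rle_trans; [apply Cmod_le_fst_snd|]. simpl.
  unfold Rminus in *. lra.
Qed.

(** The affine part of [F] at [(p, q)] has differences [snd l * h] and [snd l * w] between opposite
    sides, whose integrals cancel. What remains is the error of differentiability,
    [eps / 2 * (w + h)] on each side. *)
Lemma rect_int_small (F : C -> C) (p q eps : R) (l : C) :
  is_cderive F (p, q) l -> (0 < eps)%R ->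
  exists d, (0 < d)%R /\ forall x y w h, (0 <= w < d)%R -> (0 <= h < d)%R ->
    (x <= p <= x + w)%R -> (y <= q <= y + h)%R -> cdiff_bd F x (x + w) y (y + h) ->
    (Rabs (rect_int F x (x + w) y (y + h)) <= eps * ((w + h) * (w + h)))%R.
Proof.
  intros HF Heps. destruct (HF (eps / 2)%R) as [d [Hd Hb]]; [lra|].
  exists (d / 2)%R. split; [lra|]. intros x y w h Hw Hh Hp Hq HD.
  assert (Hz : forall s t, (x <= s <= x + w)%R -> (y <= t <= y + h)%R ->
    (Cmod (F (s, t) - F (p, q) - l * ((s, t) - (p, q)))%C <= eps / 2 * (w + h))%R).
  { intros s t Hs Ht.
    assert (Hk : (Cmod ((s, t) - (p, q))%C <= w + h)%R)
      by (apply Cmod_pair_sub_le; apply Rabs_le; lra).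
    assert (Hk' : (Cmod ((s, t) - (p, q))%C < d)%R) by lra.
    specialize (Hb ((s, t) - (p, q)) Hk').
    replace ((p, q) + ((s, t) - (p, q))) with (s, t) in Hb
      by (apply injective_projections; simpl; ring).
    eapply Rle_trans; [exact Hb|]. apply Rmult_le_compat_l; lra. }
  replace (rect_int F x (x + w) y (y + h))
    with (rect_int F x (x + w) y (y + h)
          - (scal (x + w - x) (snd l * h) - scal (y + h - y) (snd l * w)))%R
    by (unfold scal; simpl; unfold mult; simpl; ring).
  eapply Rle_trans.
  - apply (rect_int_near F (fun _ => snd l * h)%R (fun _ => snd l * w)%R
      x (x + w) y (y + h) _ _ (eps * (w + h))%R); try lra; try easy; try apply @is_RInt_const.
    + intros s Hs.
      pose proof (Hz s y Hs ltac:(lra)) as Z1. pose proof (Hz s (y + h)%R Hs ltac:(lra)) as Z2.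
      apply (Rle_trans _ _ _ (fst_le_Cmod _)) in Z1.
      apply (Rle_trans _ _ _ (fst_le_Cmod _)) in Z2.
      simpl in Z1, Z2. apply Rabs_le_between in Z1, Z2. apply Rabs_le. lra.
    + intros t Ht.
      pose proof (Hz x t ltac:(lra) Ht) as Z1. pose proof (Hz (x + w)%R t ltac:(lra) Ht) as Z2.
      apply (Rle_trans _ _ _ (snd_le_Cmod _)) in Z1.
      apply (Rle_trans _ _ _ (snd_le_Cmod _)) in Z2.
      simpl in Z1, Z2. apply Rabs_le_between in Z1, Z2. apply Rabs_le. lra.
  - apply Req_le. ring.
Qed.

Lemma goursat (F : C -> C) (a b c d : R) :
  (a <= b)%R -> (c <= d)%R -> cdiff_on F a b c d -> rect_int F a b c d = 0%R.
Proof.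
  intros Hab Hcd HF.
  assert (H : forall eps, (0 < eps)%R ->
    (Rabs (rect_int F a b c d) <= eps * ((b - a + (d - c)) * (b - a + (d - c))))%R).
  { intros eps Heps.
    (* The bound is quadratic in the size, so the bounds of four quarters add up exactly to the
       bound of the whole. *)
    pose (P := fun x y w h => (a <= x -> x + w <= b -> c <= y -> y + h <= d ->
      Rabs (rect_int F x (x + w) y (y + h)) <= eps * ((w + h) * (w + h)))%R).
    assert (HP : P a c (b - a)%R (d - c)%R).
    { apply rectangle_bisection; [lra|lra| |].
      - intros x y w h Hw Hh P1 P2 P3 P4 A1 A2 A3 A4.
        specialize (P1 ltac:(lra) ltac:(lra) ltac:(lra) ltac:(lra)).
        specialize (P2 ltac:(lra) ltac:(lra) ltac:(lra) ltac:(lra)).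
        specialize (P3 ltac:(lra) ltac:(lra) ltac:(lra) ltac:(lra)).
        specialize (P4 ltac:(lra) ltac:(lra) ltac:(lra) ltac:(lra)).
        replace (x + (w + w))%R with (x + w + w)%R by ring.
        replace (y + (h + h))%R with (y + h + h)%R by ring.
        rewrite (rect_int_split_x F x (x + w)) by (try lra; intros; apply HF; lra).
        rewrite (rect_int_split_y F x (x + w) y (y + h)) by (try lra; intros; apply HF; lra).
        rewrite (rect_int_split_y F (x + w) (x + w + w) y (y + h))
          by (try lra; intros; apply HF; lra).
        apply Rabs_le_between in P1, P2, P3, P4. apply Rabs_le. lra.
      - intros p q Hp Hq. destruct (HF p q ltac:(lra) ltac:(lra)) as [l Hl].
        destruct (rect_int_small F p q eps l Hl Heps) as [dl [Hdl Hs]].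
        exists dl. split; [easy|]. intros x' y' w' h' Hw' Hh' Hx' Hy' A1 A2 A3 A4.
        apply Hs; try easy. apply cdiff_on_bd; [lra|lra|].
        intros s t Hs' Ht'. apply HF; lra. }
    specialize (HP ltac:(lra) ltac:(lra) ltac:(lra) ltac:(lra)).
    now replace (a + (b - a))%R with b in HP by ring;
      replace (c + (d - c))%R with d in HP by ring. }
  set (K := ((b - a + (d - c)) * (b - a + (d - c)))%R) in *.
  assert (HK : (0 <= K)%R) by (unfold K; nra).
  apply Rabs_eq_0. apply Rle_antisym; [|apply Rabs_pos].
  apply Rnot_lt_le. intros Hlt.
  specialize (H (Rabs (rect_int F a b c d) / (2 * (K + 1)))%R
    ltac:(apply Rdiv_lt_0_compat; lra)).
  set (X := Rabs (rect_int F a b c d)) in *.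
  assert (X / (2 * (K + 1)) * (2 * (K + 1)) = X)%R by (field; lra).
  assert (0 < X / (2 * (K + 1)))%R by (apply Rdiv_lt_0_compat; lra).
  nra.
Qed.

(** Cutting off the strips to the left, to the right, below and above leaves the small square. The
    strips avoid [(p, q)], so Goursat's theorem makes their integrals vanish. *)
Lemma rect_int_deform (F : C -> C) (a b c d p q s : R) :
  (0 < s)%R -> (a <= p - s)%R -> (p + s <= b)%R -> (c <= q - s)%R -> (q + s <= d)%R ->
  (forall x y, (a <= x <= b)%R -> (c <= y <= d)%R -> (x, y) <> (p, q) ->
     exists l, is_cderive F (x, y) l) ->
  rect_int F a b c d = rect_int F (p - s) (p + s) (q - s) (q + s).
Proof.
  intros Hs Ha Hb Hc Hd HF.
  assert (HX : forall x y, (a <= x <= b)%R -> (c <= y <= d)%R -> (x < p \/ p < x)%R ->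
     exists l, is_cderive F (x, y) l).
  { intros x y Hx Hy Hn. apply HF; try easy. intros [= -> ->]. lra. }
  assert (HY : forall x y, (a <= x <= b)%R -> (c <= y <= d)%R -> (y < q \/ q < y)%R ->
     exists l, is_cderive F (x, y) l).
  { intros x y Hx Hy Hn. apply HF; try easy. intros [= -> ->]. lra. }
  rewrite (rect_int_split_x F a (p - s) b) by (try lra; intros; apply HY; lra).
  rewrite (goursat F a (p - s)) by (try lra; intros ? ? ? ?; apply HX; lra).
  rewrite (rect_int_split_x F (p - s) (p + s) b) by (try lra; intros; apply HY; lra).
  rewrite (goursat F (p + s) b) by (try lra; intros ? ? ? ?; apply HX; lra).
  rewrite (rect_int_split_y F (p - s) (p + s) c (q - s)) by (try lra; intros; apply HX; lra).
  rewrite (goursat F (p - s) (p + s) c) by (try lra; intros ? ? ? ?; apply HY; lra).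
  rewrite (rect_int_split_y F (p - s) (p + s) (q - s) (q + s))
    by (try lra; intros; apply HX; lra).
  rewrite (goursat F (p - s) (p + s) (q + s)) by (try lra; intros ? ? ? ?; apply HY; lra).
  ring.
Qed.

(** With [u = x - x0], a primitive is [- 2 A s / (u^2 + s^2) + 2 B atan (u / s)]. Its first term is
    even and cancels at the ends; the second contributes [PI / 4] twice. *)
Lemma is_RInt_cauchy_kernel (A B s x0 : R) :
  (0 < s)%R ->
  is_RInt (fun x => A * (4 * s * (x - x0) / ((x - x0) ^ 2 + s ^ 2) ^ 2)
                    + B * (2 * s / ((x - x0) ^ 2 + s ^ 2)))%R
    (x0 - s) (x0 + s) (B * PI)%R.
Proof.
  intros Hs.
  assert (Hp : forall x, (0 < (x - x0) ^ 2 + s ^ 2)%R).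
  { intros x. pose proof (pow2_ge_0 (x - x0)). assert (0 < s ^ 2)%R by (apply pow_lt; lra). lra. }
  pose (G := fun x => (A * (- (2 * s) / ((x - x0) ^ 2 + s ^ 2)) + 2 * B * atan ((x - x0) / s))%R).
  replace (B * PI)%R with (minus (G (x0 + s)%R) (G (x0 - s)%R)).
  - apply @is_RInt_derive.
    + intros x _. unfold G. auto_derive.
      * repeat split; auto; try lra. specialize (Hp x). simpl in Hp. lra.
      * specialize (Hp x). field. split; lra.
    + intros x _. apply @ex_derive_continuous. auto_derive.
      specialize (Hp x). simpl in Hp.
      repeat split; auto; try lra; intros E; nra.
  - unfold G, minus, plus, opp; simpl.
    replace ((x0 + s - x0) / s)%R with 1%R by (field; lra).
    replace ((x0 - s - x0) / s)%R with (- (1))%R by (field; lra).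
    rewrite atan_opp, atan_1. 
    replace (x0 + s - x0)%R with s by ring. replace (x0 - s - x0)%R with (- s)%R by ring.
    field. nra.
Qed.

(** First order expansion of the integrand [f(t) / (t - p)^2] at the pole, with [xi = t - p],
    [u = f(t)], [h0 = f(p)] and [l = f'(p)]: dividing the differentiability error by [xi^2] leaves
    [eps / Cmod xi]. *)
Lemma cauchy_kernel_expansion (u h0 l xi : C) (eps : R) :
  xi <> 0 -> (Cmod (u - h0 - l * xi)%C <= eps * Cmod xi)%R ->
  (Cmod (u * (/ xi * / xi) - (h0 * (/ xi * / xi) + l * / xi))%C <= eps / Cmod xi)%R.
Proof.
  intros Hxi H.
  replace (u * (/ xi * / xi) - (h0 * (/ xi * / xi) + l * / xi))
    with ((u - h0 - l * xi) * (/ xi * / xi)) by (field; easy).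
  rewrite !Cmod_mult, Cmod_inv by easy.
  assert (HX : (0 < Cmod xi)%R) by now apply Cmod_gt_0.
  replace (eps / Cmod xi)%R with (eps * Cmod xi * (/ Cmod xi * / Cmod xi))%R
    by (field; lra).
  apply Rmult_le_compat_r; [|easy].
  apply Rmult_le_pos; apply Rlt_le, Rinv_0_lt_compat; easy.
Qed.

(** Bottom side minus top side of the principal part. The double pole yields a term odd in [t],
    which integrates to zero; the simple pole yields the arctangent kernel that carries [snd l]. *)
Lemma cauchy_kernel_horizontal (h0 l : C) (t s : R) :
  (0 < s)%R ->
  (fst (h0 * (/ (t, - s)%R * / (t, - s)%R) + l * / (t, - s)%R)%C
   - fst (h0 * (/ (t, s) * / (t, s)) + l * / (t, s))%C
   = - snd h0 * (4 * s * t / (t ^ 2 + s ^ 2) ^ 2)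
     + - snd l * (2 * s / (t ^ 2 + s ^ 2)))%R.
Proof.
  intros Hs. destruct h0 as [a b]. destruct l as [c d]. simpl.
  field. assert (0 < s * s)%R by nra. repeat split; nra.
Qed.

Lemma cauchy_kernel_vertical (h0 l : C) (t s : R) :
  (0 < s)%R ->
  (snd (h0 * (/ (s, t) * / (s, t)) + l * / (s, t))%C
   - snd (h0 * (/ (- s, t)%R * / (- s, t)%R) + l * / (- s, t)%R)%C
   = - fst h0 * (4 * s * t / (t ^ 2 + s ^ 2) ^ 2)
     + snd l * (2 * s / (t ^ 2 + s ^ 2)))%R.
Proof.
  intros Hs. destruct h0 as [a b]. destruct l as [c d]. simpl.
  field. assert (0 < s * s)%R by nra. repeat split; nra.
Qed.

Definition cauchy_integrand (f : C -> C) (p : C) : C -> C :=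
  fun t => f t * (/ (t - p) * / (t - p)).

Lemma cauchy_integrand_cdiff (f : C -> C) (p z l : C) :
  is_cderive f z l -> z <> p -> exists m, is_cderive (cauchy_integrand f p) z m.
Proof.
  intros Hf Hz. eexists. unfold cauchy_integrand.
  apply is_cderive_mult; [exact Hf|].
  apply (is_cderive_mult (fun t => / (t - p)) (fun t => / (t - p)));
    now apply is_cderive_inv_sub.
Qed.

Lemma Cmod_ge_fst (x y s : R) : (s <= Rabs x -> s <= Cmod (x, y))%R.
Proof. intros H. eapply Rle_trans; [exact H|apply (fst_le_Cmod (x, y))]. Qed.

Lemma Cmod_ge_snd (x y s : R) : (s <= Rabs y -> s <= Cmod (x, y))%R.
Proof. intros H. eapply Rle_trans; [exact H|apply (snd_le_Cmod (x, y))]. Qed.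

Lemma Csub_pair (a b c d : R) : (a, b) - (c, d) = (a - c, b - d)%R.
Proof. reflexivity. Qed.

(* Only the real part of the contour integral is computed, hence only the
   imaginary part of the derivative appears; the real part is recovered from [Ci * f]. *)
Lemma cauchy_derivative (f : C -> C) (a b c d p q : R) (l : C) :
  (a < p < b)%R -> (c < q < d)%R -> cdiff_on f a b c d -> is_cderive f (p, q) l ->
  rect_int (cauchy_integrand f (p, q)) a b c d = (- (2 * PI * snd l))%R.
Proof.
  intros Hp Hq Hf Hl.
  set (F := cauchy_integrand f (p, q)).
  assert (HF : forall x y, (a <= x <= b)%R -> (c <= y <= d)%R -> (x, y) <> (p, q) ->
     exists l, is_cderive F (x, y) l).
  { intros x y Hx Hy Hn. destruct (Hf x y Hx Hy) as [m Hm].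
    now apply cauchy_integrand_cdiff with m. }
  assert (H : forall eps, (0 < eps)%R ->
    (Rabs (rect_int F a b c d - (- (2 * PI * snd l))) <= 8 * eps)%R).
  { intros eps Heps. destruct (Hl eps Heps) as [dl [Hdl Hb]].
    (* The square of half-side [s] lies inside the rectangle, and its points are at distance at most
       [2 * s < dl] from the pole, where the expansion holds. *)
    set (s := Rmin (dl / 4) (Rmin (Rmin (p - a) (b - p)) (Rmin (q - c) (d - q)))).
    assert (Hs : (0 < s)%R) by (unfold s; repeat apply Rmin_pos; lra).
    assert (s <= dl / 4)%R by apply Rmin_l.
    assert (Hs' : (s <= Rmin (Rmin (p - a) (b - p)) (Rmin (q - c) (d - q)))%R) by apply Rmin_r.
    pose proof (Rmin_l (Rmin (p - a) (b - p)) (Rmin (q - c) (d - q))).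
    pose proof (Rmin_r (Rmin (p - a) (b - p)) (Rmin (q - c) (d - q))).
    pose proof (Rmin_l (p - a) (b - p)). pose proof (Rmin_r (p - a) (b - p)).
    pose proof (Rmin_l (q - c) (d - q)). pose proof (Rmin_r (q - c) (d - q)).
    clearbody s.
    rewrite (rect_int_deform F a b c d p q s) by (try easy; lra).
    assert (HE : forall x y, (Rabs x <= s)%R -> (Rabs y <= s)%R ->
      (s <= Rabs x \/ s <= Rabs y)%R ->
      (Cmod (F (p + x, q + y)%R
        - (f (p, q) * (/ (x, y) * / (x, y)) + l * / (x, y)))%C <= eps / s)%R).
    { intros x y Hx Hy Hxy.
      assert (HX : (s <= Cmod (x, y))%R)
        by (destruct Hxy; [now apply Cmod_ge_fst|now apply Cmod_ge_snd]).
      assert (HX' : (Cmod (x, y) < dl)%R).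
      { pose proof (Cmod_le_fst_snd (x, y)) as Hc. simpl in Hc. lra. }
      assert (Hn : (x, y) <> RtoC 0) by (apply Cmod_gt_0; lra).
      specialize (Hb (x, y) HX').
      apply (Rle_trans _ (eps / Cmod (x, y))).
      - unfold F, cauchy_integrand.
        replace ((p + x, q + y)%R - (p, q)) with (x, y)
          by (apply injective_projections; simpl; ring).
        apply cauchy_kernel_expansion; easy.
      - apply Rmult_le_compat_l; [lra|]. apply Rinv_le_contravar; lra. }
    replace (- (2 * PI * snd l))%R with (- snd l * PI - snd l * PI)%R by ring.
    (* The error [eps / s] grows as the square shrinks, but the sides have length [2 * s], so the
       total does not depend on [s]. *)
    replace (8 * eps)%R with ((p + s - (p - s) + (q + s - (q - s))) * (2 * (eps / s)))%R
      by (field; lra).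
    eapply rect_int_near;
      [lra|lra| |apply (is_RInt_cauchy_kernel (- snd (f (p, q)))); easy
      |apply (is_RInt_cauchy_kernel (- fst (f (p, q)))); easy| |].
    - repeat split; intros t Ht; apply HF; try lra; intros [=]; lra.
    - intros x Hx. cbv beta.
      rewrite <- cauchy_kernel_horizontal by easy.
      pose proof (HE (x - p)%R (- s)%R) as E1. pose proof (HE (x - p)%R s) as E2.
      rewrite Rabs_Ropp in E1. rewrite (Rabs_right s) in E1, E2 by lra.
      specialize (E1 ltac:(apply Rabs_le; lra) ltac:(lra) ltac:(lra)).
      specialize (E2 ltac:(apply Rabs_le; lra) ltac:(lra) ltac:(lra)).
      replace (p + (x - p))%R with x in E1, E2 by ring.
      apply (Rle_trans _ _ _ (fst_lipschitz _ _)) in E1, E2.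
      change (q + - s)%R with (q - s)%R in E1.
      apply Rabs_le_between in E1, E2. apply Rabs_le. lra.
    - intros y Hy. cbv beta.
      rewrite <- cauchy_kernel_vertical by easy.
      pose proof (HE (- s)%R (y - q)%R) as E1. pose proof (HE s (y - q)%R) as E2.
      rewrite Rabs_Ropp in E1. rewrite (Rabs_right s) in E1, E2 by lra.
      specialize (E1 ltac:(lra) ltac:(apply Rabs_le; lra) ltac:(lra)).
      specialize (E2 ltac:(lra) ltac:(apply Rabs_le; lra) ltac:(lra)).
      replace (q + (y - q))%R with y in E1, E2 by ring.
      apply (Rle_trans _ _ _ (snd_lipschitz _ _)) in E1, E2.
      change (p + - s)%R with (p - s)%R in E1.
      apply Rabs_le_between in E1, E2. apply Rabs_le. lra. }
  apply Rminus_diag_uniq. apply Rabs_eq_0. apply Rle_antisym; [|apply Rabs_pos].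
  apply Rnot_lt_le. intros Hlt.
  specialize (H (Rabs (rect_int F a b c d - - (2 * PI * snd l)) / 16)%R ltac:(lra)). lra.
Qed.

Lemma rect_int_minus (F G : C -> C) (a b c d : R) :
  (a <= b)%R -> (c <= d)%R -> cdiff_bd F a b c d -> cdiff_bd G a b c d ->
  rect_int (fun t => F t - G t) a b c d = (rect_int F a b c d - rect_int G a b c d)%R.
Proof.
  intros Hab Hcd (F1 & F2 & F3 & F4) (G1 & G2 & G3 & G4). unfold rect_int.
  assert (E1 : forall y, (forall x, (a <= x <= b)%R -> exists l, is_cderive F (x, y) l) ->
    (forall x, (a <= x <= b)%R -> exists l, is_cderive G (x, y) l) ->
    (RInt (fun x => fst (F (x, y) - G (x, y))%C) a b
     = RInt (fun x => fst (F (x, y))) a b - RInt (fun x => fst (G (x, y))) a b)%R).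
  { intros y HF HG. apply (RInt_minus (V := R_CompleteNormedModule)
      (fun x => fst (F (x, y))) (fun x => fst (G (x, y)))); now apply ex_RInt_horizontal. }
  assert (E2 : forall x, (forall y, (c <= y <= d)%R -> exists l, is_cderive F (x, y) l) ->
    (forall y, (c <= y <= d)%R -> exists l, is_cderive G (x, y) l) ->
    (RInt (fun y => snd (F (x, y) - G (x, y))%C) c d
     = RInt (fun y => snd (F (x, y))) c d - RInt (fun y => snd (G (x, y))) c d)%R).
  { intros y HF HG. apply (RInt_minus (V := R_CompleteNormedModule)
      (fun x => snd (F (y, x))) (fun x => snd (G (y, x)))); now apply ex_RInt_vertical. }
  rewrite !E1, !E2 by easy. ring.
Qed.

(** * Cauchy estimates on squares *)

Definition square_bound (f : C -> C) (x0 y0 r M : R) : Prop :=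
  forall x y, (x0 - r <= x <= x0 + r)%R -> (y0 - r <= y <= y0 + r)%R ->
    (Cmod (f (x, y)) <= M)%R.

Definition cdiff_on_square (f : C -> C) (x0 y0 r : R) : Prop :=
  cdiff_on f (x0 - r) (x0 + r) (y0 - r) (y0 + r).

(** Multiplication by [Ci] turns the real part into the imaginary part; this passage from one
    component to the modulus costs the factor 2. *)
Lemma Cmod_le_of_snd (l : C) (B : R) :
  (Rabs (snd l) <= B -> Rabs (snd (Ci * l)%C) <= B -> Cmod l <= 2 * B)%R.
Proof.
  intros H1 H2. replace (snd (Ci * l)%C) with (fst l) in H2 by (destruct l; simpl; ring).
  pose proof (Cmod_le_fst_snd l). lra.
Qed.

Lemma cdiff_on_square_Ci (f : C -> C) (x0 y0 r : R) :
  cdiff_on_square f x0 y0 r -> cdiff_on_square (fun t => Ci * f t) x0 y0 r.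
Proof.
  intros H x y Hx Hy. destruct (H x y Hx Hy) as [m Hm]. eexists.
  apply is_cderive_scal. exact Hm.
Qed.

Lemma square_bound_Ci (f : C -> C) (x0 y0 r M : R) :
  square_bound f x0 y0 r M -> square_bound (fun t => Ci * f t) x0 y0 r M.
Proof.
  intros H x y Hx Hy. rewrite Cmod_mult, Cmod_Ci, Rmult_1_l. now apply H.
Qed.

Lemma cauchy_integrand_cdiff_bd (f : C -> C) (x0 y0 r : R) (p q : R) :
  (x0 - r < p < x0 + r)%R -> (y0 - r < q < y0 + r)%R -> cdiff_on_square f x0 y0 r ->
  cdiff_bd (cauchy_integrand f (p, q)) (x0 - r) (x0 + r) (y0 - r) (y0 + r).
Proof.
  intros Hp Hq Hf.
  assert (HF : forall x y, (x0 - r <= x <= x0 + r)%R -> (y0 - r <= y <= y0 + r)%R ->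
    (x, y) <> (p, q) -> exists l, is_cderive (cauchy_integrand f (p, q)) (x, y) l).
  { intros x y Hx Hy Hn. destruct (Hf x y Hx Hy) as [m Hm].
    now apply cauchy_integrand_cdiff with m. }
  repeat split; intros t Ht; apply HF; try lra; intros [=]; lra.
Qed.

Lemma cauchy_estimate_snd (f : C -> C) (x0 y0 r M : R) (l : C) :
  (0 < r)%R -> cdiff_on_square f x0 y0 r -> square_bound f x0 y0 r M ->
  is_cderive f (x0, y0) l -> (Rabs (snd l) <= 2 * M / r)%R.
Proof.
  intros Hr Hf HM Hl.
  assert (HM0 : (0 <= M)%R).
  { eapply Rle_trans; [apply Cmod_ge_0|apply (HM x0 y0); lra]. }
  pose proof (cauchy_derivative f (x0 - r) (x0 + r) (y0 - r) (y0 + r) x0 y0 l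
    ltac:(lra) ltac:(lra) Hf Hl) as E.
  assert (HB : forall x y, (x0 - r <= x <= x0 + r)%R -> (y0 - r <= y <= y0 + r)%R ->
    (r <= Rabs (x - x0) \/ r <= Rabs (y - y0))%R ->
    (Cmod (cauchy_integrand f (x0, y0) (x, y)) <= M * (/ r * / r))%R).
  { intros x y Hx Hy Hxy. unfold cauchy_integrand. rewrite Csub_pair.
    assert (HX : (r <= Cmod (x - x0, y - y0)%R)%R)
      by (destruct Hxy; [now apply Cmod_ge_fst|now apply Cmod_ge_snd]).
    assert (Hn : (x - x0, y - y0)%R <> RtoC 0) by (apply Cmod_gt_0; lra).
    rewrite !Cmod_mult, Cmod_inv by easy.
    assert (/ Cmod (x - x0, y - y0)%R <= / r)%R by (apply Rinv_le_contravar; lra).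
    assert (0 < / Cmod (x - x0, y - y0)%R)%R by (apply Rinv_0_lt_compat; lra).
    apply Rmult_le_compat; [apply Cmod_ge_0|nra|now apply HM|nra]. }
  assert (H := rect_int_bound (cauchy_integrand f (x0, y0)) (x0 - r) (x0 + r) (y0 - r) (y0 + r)
    (M * (/ r * / r)) ltac:(lra) ltac:(lra)
    (cauchy_integrand_cdiff_bd f x0 y0 r x0 y0 ltac:(lra) ltac:(lra) Hf)).
  rewrite E in H.
  replace ((x0 + r - (x0 - r) + (y0 + r - (y0 - r))) * (2 * (M * (/ r * / r))))%R
    with (8 * M / r)%R in H by (field; lra).
  assert (Hr' : (r <= Rabs r)%R) by (rewrite Rabs_right; lra).
  assert (Hr'' : (r <= Rabs (- r))%R) by (rewrite Rabs_Ropp, Rabs_right; lra).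
  specialize (H ltac:(intros x Hx; split; apply HB; try lra; right;
    [replace (y0 - r - y0)%R with (- r)%R by ring|replace (y0 + r - y0)%R with r by ring];
    easy)).
  specialize (H ltac:(intros x Hx; split; apply HB; try lra; left;
    [replace (x0 - r - x0)%R with (- r)%R by ring|replace (x0 + r - x0)%R with r by ring];
    easy)).
  rewrite Rabs_Ropp, Rabs_mult, Rabs_right in H by (pose proof PI_RGT_0; lra).
  (* The contour bound reads [2 * PI * Rabs (snd l) <= 4 * (2 * M / r)], and [2 * PI] exceeds 4. *)
  pose proof PI2_3_2. pose proof (Rabs_pos (snd l)).
  replace (8 * M / r)%R with (4 * (2 * M / r))%R in H by (field; lra).
  nra.
Qed.

Lemma cauchy_estimate (f : C -> C) (x0 y0 r M : R) (l : C) :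
  (0 < r)%R -> cdiff_on_square f x0 y0 r -> square_bound f x0 y0 r M ->
  is_cderive f (x0, y0) l -> (Cmod l <= 4 * M / r)%R.
Proof.
  intros Hr Hf HM Hl.
  replace (4 * M / r)%R with (2 * (2 * M / r))%R by (field; lra).
  apply Cmod_le_of_snd.
  - now apply cauchy_estimate_snd with f x0 y0.
  - apply cauchy_estimate_snd with (fun t => Ci * f t) x0 y0; try easy.
    + now apply cdiff_on_square_Ci.
    + now apply square_bound_Ci.
    + now apply is_cderive_scal.
Qed.

(** From [1/v^2 - 1/u^2 = (u - v) (1/(v^2 u) + 1/(v u^2))]: with [1/|u| <= 1/r] and [1/|v| <= 2/r]
    the two summands contribute 4 and 2, hence the 6. *)
Lemma cauchy_kernel_diff (u v : C) (r : R) :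
  (0 < r)%R -> (r <= Cmod u)%R -> (r / 2 <= Cmod v)%R ->
  (Cmod (/ v * / v - / u * / u)%C <= 6 * Cmod (u - v)%C / (r * r * r))%R.
Proof.
  intros Hr Hu Hv.
  assert (Hu0 : u <> 0) by (apply Cmod_gt_0; lra).
  assert (Hv0 : v <> 0) by (apply Cmod_gt_0; lra).
  replace (/ v * / v - / u * / u)
    with ((u - v) * (/ v * (/ v * / u) + / v * (/ u * / u))) by (field; easy).
  rewrite Cmod_mult.
  replace (6 * Cmod (u - v)%C / (r * r * r))%R
    with (Cmod (u - v)%C * (6 * (/ r * (/ r * / r))))%R by (field; lra).
  apply Rmult_le_compat_l; [apply Cmod_ge_0|].
  eapply Rle_trans; [apply Cmod_triangle|]. rewrite !Cmod_mult, !Cmod_inv by easy.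
  assert (0 < / r)%R by (apply Rinv_0_lt_compat; lra).
  assert (/ Cmod u <= / r)%R by (apply Rinv_le_contravar; lra).
  assert (/ Cmod v <= 2 * / r)%R.
  { replace (2 * / r)%R with (/ (r / 2))%R by (field; lra). apply Rinv_le_contravar; lra. }
  assert (0 < / Cmod u)%R by (apply Rinv_0_lt_compat; lra).
  assert (0 < / Cmod v)%R by (apply Rinv_0_lt_compat; lra).
  set (U := (/ Cmod u)%R) in *. set (V := (/ Cmod v)%R) in *. set (k := (/ r)%R) in *.
  assert (V * U <= 2 * k * k)%R by (apply Rmult_le_compat; lra).
  assert (U * U <= k * k)%R by (apply Rmult_le_compat; lra).
  assert (V * (V * U) <= 2 * k * (2 * k * k))%R by (apply Rmult_le_compat; nra).
  assert (V * (U * U) <= 2 * k * (k * k))%R by (apply Rmult_le_compat; nra).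
  lra.
Qed.

(** Both derivatives are represented on the same square around [(x0, y0)], so their difference is
    the integral of [f] against a difference of kernels, which is of order [e]. The displaced pole
    stays at distance [r / 2] from the vertical sides. The contour bound is
    [6 * (8 * M * Rabs e / r^2)] and [2 * PI] exceeds 6. *)
Lemma cauchy_estimate_diff_snd (f : C -> C) (x0 y0 r e M : R) (l l' : C) :
  (0 < r)%R -> (Rabs e <= r / 2)%R ->
  cdiff_on_square f x0 y0 r -> square_bound f x0 y0 r M ->
  is_cderive f (x0, y0) l -> is_cderive f (x0 + e, y0)%R l' ->
  (Rabs (snd (l' - l)%C) <= 8 * M * Rabs e / (r * r))%R.
Proof.
  intros Hr He Hf HM Hl Hl'.
  pose proof (proj1 (Rabs_le_between _ _) He) as He'.
  assert (HM0 : (0 <= M)%R).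
  { eapply Rle_trans; [apply Cmod_ge_0|apply (HM x0 y0); lra]. }
  pose proof (cauchy_derivative f (x0 - r) (x0 + r) (y0 - r) (y0 + r) x0 y0 l
    ltac:(lra) ltac:(lra) Hf Hl) as E.
  pose proof (cauchy_derivative f (x0 - r) (x0 + r) (y0 - r) (y0 + r) (x0 + e) y0 l'
    ltac:(lra) ltac:(lra) Hf Hl') as E'.
  pose proof (cauchy_integrand_cdiff_bd f x0 y0 r x0 y0 ltac:(lra) ltac:(lra) Hf) as D.
  pose proof (cauchy_integrand_cdiff_bd f x0 y0 r (x0 + e) y0 ltac:(lra) ltac:(lra) Hf) as D'.
  set (G := fun t => cauchy_integrand f (x0 + e, y0)%R t - cauchy_integrand f (x0, y0) t).
  pose proof (rect_int_minus _ _ (x0 - r) (x0 + r) (y0 - r) (y0 + r)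
    ltac:(lra) ltac:(lra) D' D) as EE.
  rewrite E, E' in EE. fold G in EE.
  assert (DG : cdiff_bd G (x0 - r) (x0 + r) (y0 - r) (y0 + r)).
  { destruct D as (D1 & D2 & D3 & D4). destruct D' as (D1' & D2' & D3' & D4').
    split; [|split; [|split]]; intros t Ht;
      [destruct (D1 t Ht) as [m Hm]; destruct (D1' t Ht) as [m' Hm']
      |destruct (D2 t Ht) as [m Hm]; destruct (D2' t Ht) as [m' Hm']
      |destruct (D3 t Ht) as [m Hm]; destruct (D3' t Ht) as [m' Hm']
      |destruct (D4 t Ht) as [m Hm]; destruct (D4' t Ht) as [m' Hm']];
      exists (m' - m); now apply is_cderive_minus. }
  assert (HB : forall x y, (x0 - r <= x <= x0 + r)%R -> (y0 - r <= y <= y0 + r)%R ->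
    ((r <= Rabs (x - x0) /\ r / 2 <= Rabs (x - (x0 + e))) \/ r <= Rabs (y - y0))%R ->
    (Cmod (G (x, y)) <= M * (6 * Rabs e / (r * r * r)))%R).
  { intros x y Hx Hy Hxy. unfold G, cauchy_integrand. rewrite !Csub_pair.
    assert (HX : (r <= Cmod (x - x0, y - y0)%R)%R)
      by (destruct Hxy as [[? ?]|?]; [now apply Cmod_ge_fst|now apply Cmod_ge_snd]).
    assert (HX' : (r / 2 <= Cmod (x - (x0 + e), y - y0)%R)%R)
      by (destruct Hxy as [[? ?]|?]; [now apply Cmod_ge_fst|apply Cmod_ge_snd; lra]).
    pose proof (cauchy_kernel_diff _ _ r Hr HX HX') as K.
    rewrite Csub_pair in K.
    replace (x - x0 - (x - (x0 + e)), y - y0 - (y - y0))%R with (RtoC e) in K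
      by (apply injective_projections; simpl; ring).
    rewrite Cmod_R in K.
    set (u := (x - x0, y - y0)%R) in *. set (v := (x - (x0 + e), y - y0)%R) in *.
    replace (f (x, y) * (/ v * / v) - f (x, y) * (/ u * / u))
      with (f (x, y) * (/ v * / v - / u * / u)) by ring.
    rewrite Cmod_mult.
    apply Rmult_le_compat; [apply Cmod_ge_0|apply Cmod_ge_0|now apply HM|exact K]. }
  assert (H := rect_int_bound G (x0 - r) (x0 + r) (y0 - r) (y0 + r)
    (M * (6 * Rabs e / (r * r * r))) ltac:(lra) ltac:(lra) DG).
  rewrite EE in H.
  replace ((x0 + r - (x0 - r) + (y0 + r - (y0 - r))) * (2 * (M * (6 * Rabs e / (r * r * r)))))%R
    with (6 * (8 * M * Rabs e / (r * r)))%R in H by (field; lra).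
  specialize (H ltac:(intros x Hx; split; apply HB; try lra; right;
    [replace (y0 - r - y0)%R with (- r)%R by ring; rewrite Rabs_Ropp
    |replace (y0 + r - y0)%R with r by ring]; rewrite Rabs_right; lra)).
  specialize (H ltac:(intros x Hx; split; apply HB; try lra; left;
    [replace (x0 - r - x0)%R with (- r)%R by ring;
     replace (x0 - r - (x0 + e))%R with (- (r + e))%R by ring; rewrite !Rabs_Ropp
    |replace (x0 + r - x0)%R with r by ring;
     replace (x0 + r - (x0 + e))%R with (r - e)%R by ring]; rewrite !Rabs_right; lra)).
  replace (- (2 * PI * snd l') - - (2 * PI * snd l))%R
    with (- (2 * PI * snd (l' - l)%C))%R in H by (simpl; ring).
  rewrite Rabs_Ropp, Rabs_mult, Rabs_right in H by (pose proof PI_RGT_0; lra).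
  pose proof PI2_3_2. pose proof (Rabs_pos (snd (l' - l)%C)).
  set (X := (8 * M * Rabs e / (r * r))%R) in *. nra.
Qed.

Lemma cauchy_estimate_diff (f : C -> C) (x0 y0 r e M : R) (l l' : C) :
  (0 < r)%R -> (Rabs e <= r / 2)%R ->
  cdiff_on_square f x0 y0 r -> square_bound f x0 y0 r M ->
  is_cderive f (x0, y0) l -> is_cderive f (x0 + e, y0)%R l' ->
  (Cmod (l' - l)%C <= 16 * M * Rabs e / (r * r))%R.
Proof.
  intros Hr He Hf HM Hl Hl'.
  replace (16 * M * Rabs e / (r * r))%R with (2 * (8 * M * Rabs e / (r * r)))%R
    by (field; lra).
  apply Cmod_le_of_snd.
  - now apply cauchy_estimate_diff_snd with f x0 y0.
  - replace (Ci * (l' - l)) with (Ci * l' - Ci * l) by ring.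
    apply cauchy_estimate_diff_snd with (fun t => Ci * f t) x0 y0; try easy.
    + now apply cdiff_on_square_Ci.
    + now apply square_bound_Ci.
    + now apply is_cderive_scal.
    + now apply is_cderive_scal.
Qed.

(** Differentiability bounds [f] near each point, and bisection makes the bound global on the
    square. The Cauchy estimates thereby become available for functions with no bound given in
    advance. *)
Lemma cdiff_bounded (f : C -> C) (x0 y0 r : R) :
  (0 < r)%R -> cdiff_on_square f x0 y0 r -> exists M, square_bound f x0 y0 r M.
Proof.
  intros Hr Hf.
  pose (P := fun x y w h => (x0 - r <= x -> x + w <= x0 + r -> y0 - r <= y -> y + h <= y0 + r ->
    exists M, forall s t, x <= s <= x + w -> y <= t <= y + h -> Cmod (f (s, t)) <= M)%R).
  assert (HP : P (x0 - r)%R (y0 - r)%R (2 * r)%R (2 * r)%R).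
  { apply rectangle_bisection; [lra|lra| |].
    - intros x y w h Hw Hh P1 P2 P3 P4 A1 A2 A3 A4.
      destruct (P1 ltac:(lra) ltac:(lra) ltac:(lra) ltac:(lra)) as [M1 H1].
      destruct (P2 ltac:(lra) ltac:(lra) ltac:(lra) ltac:(lra)) as [M2 H2].
      destruct (P3 ltac:(lra) ltac:(lra) ltac:(lra) ltac:(lra)) as [M3 H3].
      destruct (P4 ltac:(lra) ltac:(lra) ltac:(lra) ltac:(lra)) as [M4 H4].
      exists (Rmax (Rmax M1 M2) (Rmax M3 M4)). intros s t Hs Ht.
      pose proof (Rmax_l (Rmax M1 M2) (Rmax M3 M4)).
      pose proof (Rmax_r (Rmax M1 M2) (Rmax M3 M4)).
      pose proof (Rmax_l M1 M2). pose proof (Rmax_r M1 M2).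
      pose proof (Rmax_l M3 M4). pose proof (Rmax_r M3 M4).
      destruct (Rle_dec s (x + w)); destruct (Rle_dec t (y + h)).
      + specialize (H1 s t ltac:(lra) ltac:(lra)). lra.
      + specialize (H3 s t ltac:(lra) ltac:(lra)). lra.
      + specialize (H2 s t ltac:(lra) ltac:(lra)). lra.
      + specialize (H4 s t ltac:(lra) ltac:(lra)). lra.
    - intros p q Hp Hq. destruct (Hf p q ltac:(lra) ltac:(lra)) as [l Hl].
      destruct (is_cderive_continuous f _ l Hl 1 Rlt_0_1) as [d [Hd Hb]].
      exists (d / 2)%R. split; [lra|]. intros x y w h Hw Hh Hx Hy _ _ _ _.
      exists (Cmod (f (p, q)) + 1)%R. intros s t Hs Ht.
      assert (Hk : (Cmod ((s, t) - (p, q))%C < d)%R).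
      { eapply Rle_lt_trans; [apply (Cmod_pair_sub_le s t p q w h)|lra]; apply Rabs_le; lra. }
      specialize (Hb _ Hk).
      replace ((p, q) + ((s, t) - (p, q))) with (s, t) in Hb
        by (apply injective_projections; simpl; ring).
      pose proof (Cmod_lipschitz (f (s, t)) (f (p, q))) as HL.
      apply Rabs_le_between in HL. lra. }
  destruct (HP ltac:(lra) ltac:(lra) ltac:(lra) ltac:(lra)) as [M HM].
  exists M. intros x y Hx Hy. apply HM; lra.
Qed.

Local Close Scope C_scope.

(** * The half-plane and the lower integral *)

Definition cderiv_Cplus (f df : C -> C) : Prop :=
  forall x y, 0 < x -> is_cderive f (x, y) (df (x, y)).

Lemma is_deriv_on_Cplus_iff (f df : Cx -> Cx) :
  is_deriv_on_Cplus f df <-> cderiv_Cplus f df.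
Proof.
  split.
  - intros H x y Hx. apply has_cderiv_iff. now apply H.
  - intros H [x y] Hx. apply has_cderiv_iff. now apply H.
Qed.

Lemma cderiv_Cplus_square (f df : C -> C) (x y r : R) :
  cderiv_Cplus f df -> r < x -> cdiff_on_square f x y r.
Proof. intros H Hr s t Hs Ht. eexists. apply H. lra. Qed.

(** The two Cauchy bounds are separated from the function they come from: [M] is a sup bound for a
    bounded function, but for a function in B it will be a multiple of the seminorm. *)
Definition deriv_decay (df : C -> C) (M : R) : Prop :=
  (forall x y, 0 < x -> Cmod (df (x, y)) <= 8 * M / x) /\
  (forall x y d, 0 < x -> 0 <= d ->
     Cmod (df (x + d, y)%R - df (x, y))%C <= 64 * M * d / (x * x)).

Lemma deriv_decay_of_bounded (f df : C -> C) (M : R) :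
  cderiv_Cplus f df -> (forall x y, 0 < x -> Cmod (f (x, y)) <= M) -> deriv_decay df M.
Proof.
  intros Hf HM.
  assert (HM0 : 0 <= M).
  { eapply Rle_trans; [apply Cmod_ge_0|apply (HM 1 0); lra]. }
  assert (H1 : forall x y, 0 < x -> Cmod (df (x, y)) <= 8 * M / x).
  { intros x y Hx. replace (8 * M / x) with (4 * M / (x / 2)) by (field; lra).
    apply cauchy_estimate with f x y; [lra| | |now apply Hf].
    - apply cderiv_Cplus_square with df; [easy|lra].
    - intros s t Hs Ht. apply HM. lra. }
  split; [exact H1|]. intros x y d Hx Hd.
  (* A small displacement fits the estimate on the square of half-side [x / 2]. For [d > x / 4] two
     applications of the first bound give [16 * M / x], already below the claim. *)
  destruct (Rle_dec d (x / 4)) as [Hs|Hs].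
  - replace (64 * M * d / (x * x)) with (16 * M * Rabs d / (x / 2 * (x / 2)))
      by (rewrite (Rabs_right d) by lra; field; lra).
    apply cauchy_estimate_diff with f x y; try (apply Hf; lra); try lra.
    + rewrite Rabs_right; lra.
    + apply cderiv_Cplus_square with df; [easy|lra].
    + intros s t Hs' Ht. apply HM. lra.
  - eapply Rle_trans; [apply Cmod_minus_le|].
    pose proof (H1 x y Hx) as E1. pose proof (H1 (x + d) y ltac:(lra)) as E2.
    assert (8 * M / (x + d) <= 8 * M / x).
    { apply Rmult_le_compat_l; [lra|]. apply Rinv_le_contravar; lra. }
    assert (16 * M / x <= 64 * M * d / (x * x)); [|lra].
    replace (16 * M / x) with (64 * M * (x / 4) / (x * x)) by (field; lra).
    apply Rmult_le_compat_r; [apply Rlt_le, Rinv_0_lt_compat; nra|].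
    apply Rmult_le_compat_l; lra.
Qed.

Lemma continuous_of_local_lipschitz (k : R -> R) (x K d : R) :
  0 < d -> (forall e, Rabs e <= d -> Rabs (k (x + e) - k x) <= K * Rabs e) ->
  continuous k x.
Proof.
  intros Hd HK. apply filterlim_locally. intros eps.
  assert (Hp : 0 < Rmin d (eps / (Rabs K + 1))).
  { apply Rmin_pos; [easy|]. apply Rdiv_lt_0_compat; [apply cond_pos|].
    pose proof (Rabs_pos K). lra. }
  exists (mkposreal _ Hp). intros t Ht.
  change (Rabs (t - x) < Rmin d (eps / (Rabs K + 1))) in Ht.
  change (Rabs (k t - k x) < eps).
  pose proof (Rmin_l d (eps / (Rabs K + 1))). pose proof (Rmin_r d (eps / (Rabs K + 1))).
  specialize (HK (t - x) ltac:(lra)).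
  rewrite Rplus_minus in HK.
  pose proof (Rabs_pos K). pose proof (Rle_abs K). pose proof (Rabs_pos (t - x)).
  assert (Hlt : Rabs (t - x) < eps / (Rabs K + 1)) by lra.
  apply (Rmult_lt_compat_r (Rabs K + 1)) in Hlt; [|lra].
  replace (eps / (Rabs K + 1) * (Rabs K + 1)) with (pos eps) in Hlt by (field; lra).
  nra.
Qed.

(** Continuity of the derivative is a consequence of Cauchy's formula: a local bound on [f] makes
    [df] Lipschitz near [x] along the horizontal line. *)
Lemma cderiv_continuous_horizontal (f df : C -> C) (phi : C -> R) (x y : R) :
  (forall a b, Rabs (phi a - phi b) <= Cmod (a - b)%C) ->
  cderiv_Cplus f df -> 0 < x -> continuous (fun t => phi (df (t, y))) x.
Proof.
  intros Hphi Hf Hx.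
  destruct (cdiff_bounded f x y (x / 2)) as [M HM];
    [lra|apply cderiv_Cplus_square with df; [easy|lra]|].
  apply continuous_of_local_lipschitz with (16 * M / (x / 2 * (x / 2))) (x / 4); [lra|].
  intros e He. eapply Rle_trans; [apply Hphi|].
  replace (16 * M / (x / 2 * (x / 2)) * Rabs e)
    with (16 * M * Rabs e / (x / 2 * (x / 2))) by (field; lra).
  pose proof (proj1 (Rabs_le_between _ _) He).
  apply cauchy_estimate_diff with f x y; try (apply Hf; lra); try easy; try lra.
  apply cderiv_Cplus_square with df; [easy|lra].
Qed.

(** The unit direction [e] is 1 on horizontal lines and [Ci] on vertical ones. *)
Lemma is_derive_along (f : C -> C) (gam : R -> C) (e l : C) (t : R) :
  Cmod e = 1 -> (forall h, gam (t + h) = (gam t + RtoC h * e)%C) ->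
  is_cderive f (gam t) l -> is_derive (fun s => fst (f (gam s))) t (fst (l * e)%C).
Proof.
  intros He Hg Hl. apply is_derive_Reals. intros eps Heps.
  destruct (Hl (eps / 2) ltac:(lra)) as [d [Hd Hb]].
  exists (mkposreal d Hd). intros h Hh0 Hh. simpl in Hh.
  assert (Hm : Cmod (RtoC h * e)%C = Rabs h) by (rewrite Cmod_mult, He, Cmod_R; ring).
  specialize (Hb (RtoC h * e)%C ltac:(lra)). rewrite Hm, <- Hg in Hb.
  apply (Rle_trans _ _ _ (fst_le_Cmod _)) in Hb.
  assert (Hpos : 0 < Rabs h) by now apply Rabs_pos_lt.
  replace ((fst (f (gam (t + h))) - fst (f (gam t))) / h - fst (l * e)%C)
    with (fst (f (gam (t + h)%R) - f (gam t) - l * (RtoC h * e))%C / h)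
    by (simpl; field; easy).
  unfold Rdiv. rewrite Rabs_mult, Rabs_inv.
  apply (Rmult_lt_reg_r (Rabs h)); [easy|].
  rewrite Rmult_assoc, Rinv_l by lra. nra.
Qed.

Lemma horizontal_increment_fst (f df : C -> C) (r R' y : R) :
  cderiv_Cplus f df -> 0 < r <= R' ->
  Rabs (fst (f (R', y)) - fst (f (r, y))) <= RInt (fun t => Cmod (df (t, y))) r R'.
Proof.
  intros Hf Hr.
  assert (HI : is_RInt (fun t => fst (df (t, y))) r R' (fst (f (R', y)) - fst (f (r, y)))).
  { apply (is_RInt_derive (V := R_CompleteNormedModule) (fun t => fst (f (t, y))));
      intros t Ht; rewrite Rmin_left, Rmax_right in Ht by lra.
    - replace (fst (df (t, y))) with (fst (df (t, y) * RtoC 1)%C) by (simpl; ring).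
      apply (is_derive_along f (fun s => (s, y)));
        [apply Cmod_1| |apply Hf; lra].
      intros h. apply injective_projections; simpl; ring.
    - apply cderiv_continuous_horizontal with f; [apply fst_lipschitz|easy|lra]. }
  assert (HC : is_RInt (fun t => Cmod (df (t, y))) r R' (RInt (fun t => Cmod (df (t, y))) r R')).
  { apply (RInt_correct (V := R_CompleteNormedModule)), @ex_RInt_continuous.
    intros t Ht. rewrite Rmin_left, Rmax_right in Ht by lra.
    apply cderiv_continuous_horizontal with f; [apply Cmod_lipschitz|easy|lra]. }
  refine (norm_RInt_le _ _ _ _ _ _ (proj2 Hr) _ HI HC).
  intros t _. apply fst_le_Cmod.
Qed.

Lemma cderiv_Cplus_scal (c : C) (f df : C -> C) :
  cderiv_Cplus f df -> cderiv_Cplus (fun z => c * f z)%C (fun z => c * df z)%C.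
Proof. intros H x y Hx. now apply is_cderive_scal, H. Qed.

(** The real-part estimate is applied to [f] and to [Ci * f]; adding the two components causes the
    factor 2. *)
Lemma horizontal_increment (f df : C -> C) (r R' y : R) :
  cderiv_Cplus f df -> 0 < r <= R' ->
  Cmod (f (R', y) - f (r, y))%C <= 2 * RInt (fun t => Cmod (df (t, y))) r R'.
Proof.
  intros Hf Hr.
  pose proof (horizontal_increment_fst f df r R' y Hf Hr) as H1.
  pose proof (horizontal_increment_fst _ _ r R' y (cderiv_Cplus_scal Ci f df Hf) Hr) as H2.
  rewrite (RInt_ext _ (fun t => Cmod (df (t, y)))) in H2
    by (intros t _; rewrite Cmod_mult, Cmod_Ci; apply Rmult_1_l).
  eapply Rle_trans; [apply Cmod_le_fst_snd|].
  replace (fst (Ci * f (R', y))%C - fst (Ci * f (r, y))%C)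
    with (- snd (f (R', y) - f (r, y))%C) in H2 by (simpl; ring).
  rewrite Rabs_Ropp in H2. simpl in *. unfold Rminus in H1. lra.
Qed.

Lemma B0_seminorm_nonneg (df : Cx -> Cx) (b : R) : B0_seminorm_le df b -> 0 <= b.
Proof.
  intros H.
  (* The interval is degenerate, so the integral is 0, and with negative height the step function
     lies below any modulus. *)
  replace 0 with (step_integral (fun _ => 1) (fun _ => -1) O)
    by (unfold step_integral; simpl; ring).
  apply H. split; [lra|]. split; [intros; lra|]. intros i _ al Hal t Ht.
  exists 0. rewrite Defs_Cmod. eapply Rlt_le_trans; [|apply Cmod_ge_0]. lra.
Qed.

Lemma ex_RInt_pos (g : R -> R) (r R' : R) :
  (forall t, 0 < t -> continuous g t) -> 0 < r <= R' -> ex_RInt g r R'.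
Proof.
  intros Hg Hr. apply @ex_RInt_continuous. intros t Ht.
  rewrite Rmin_left, Rmax_right in Ht by lra. apply Hg. lra.
Qed.

Lemma RInt_pos_Chasles (g : R -> R) (r s R' : R) :
  (forall t, 0 < t -> continuous g t) -> 0 < r -> r <= s <= R' ->
  RInt g r R' = RInt g r s + RInt g s R'.
Proof.
  intros Hg Hr Hs. symmetry. apply (RInt_Chasles (V := R_CompleteNormedModule));
    apply ex_RInt_pos; try easy; lra.
Qed.

Lemma RInt_pos_le_const (g : R -> R) (r R' B : R) :
  (forall t, 0 < t -> continuous g t) -> 0 < r <= R' ->
  (forall t, r <= t <= R' -> g t <= B) -> RInt g r R' <= B * (R' - r).
Proof.
  intros Hg Hr HB.
  replace (B * (R' - r)) with (RInt (fun _ => B) r R')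
    by (rewrite RInt_const; unfold scal; simpl; unfold mult; simpl; ring).
  apply RInt_le; [lra|now apply ex_RInt_pos|apply @ex_RInt_const|].
  intros t Ht. apply HB. lra.
Qed.

(** On [[r, R']] the function [k] is uniformly continuous, so its values at the nodes of a fine
    grid, lowered by [eps], form an admissible step function. It is used with [k] the modulus of
    [df] on one horizontal line, and later with [k] the vertical supremum. *)
Lemma RInt_le_B0_seminorm (df : Cx -> Cx) (b : R) (k : R -> R) (r R' : R) :
  0 < r <= R' -> (forall t, 0 < t -> continuous k t) ->
  (forall t, 0 < t -> forall u, u < k t -> exists y, u < Cmod (df (t, y))) ->
  B0_seminorm_le df b -> RInt k r R' <= b.
Proof.
  intros Hr Hc Hk Hb.
  assert (H : forall eps : posreal, RInt k r R' <= b + 2 * eps * (R' - r)).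
  { intros eps.
    assert (Hcp : forall x, r <= x <= R' -> continuity_pt k x).
    { intros x Hx. apply continuity_pt_filterlim, Hc. lra. }
    destruct (Heine_cor2 Hcp eps) as [d Hd].
    destruct (INR_archimed d (R' - r) (cond_pos d)) as [N HN].
    (* There are [S N] cells, matching the index range [0..N] of [step_below] and keeping the
       denominator nonzero. Each cell costs [2 * eps] per unit length: one [eps] for lowering the
       value, one for the oscillation of [k]. *)
    set (st := (R' - r) / INR (S N)).
    assert (HSN : 0 < INR (S N)) by (apply lt_0_INR; lia).
    assert (Hst0 : 0 <= st) by (apply Rdiv_le_0_compat; lra).
    assert (HstE : INR (S N) * st = R' - r) by (unfold st; field; lra).
    assert (Hst : st < d).
    { pose proof (cond_pos d). rewrite S_INR in *.
      apply (Rmult_lt_reg_l (INR N + 1)); [lra|]. rewrite HstE. nra. }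
    pose (x := fun i => r + INR i * st). pose (s := fun i => k (x i) - eps).
    assert (HxS : forall i, x (S i) = x i + st)
      by (intros i; unfold x; rewrite S_INR; ring).
    assert (Hxr : forall i, r <= x i).
    { intros i. unfold x. pose proof (pos_INR i). nra. }
    assert (HxR : forall i, (i <= N)%nat -> x (S i) <= R').
    { intros i Hi. unfold x. assert (INR (S i) <= INR (S N)) by (apply le_INR; lia). nra. }
    assert (HB : step_below df x s N).
    { split; [specialize (Hxr O); lra|]. split; [intros i _; rewrite HxS; lra|].
      intros i Hi al Hal t Ht.
      specialize (Hxr i). specialize (HxR i Hi). rewrite HxS in *.
      specialize (Hd (x i) al ltac:(lra) ltac:(lra) ltac:(apply Rabs_def1; lra)).
      apply Rabs_def2 in Hd. unfold s in Ht.
      destruct (Hk al ltac:(lra) t ltac:(lra)) as [y Hy].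
      exists y. rewrite Defs_Cmod. exact Hy. }
    specialize (Hb x s N HB).
    assert (Hind : forall m, (m <= N)%nat ->
      RInt k r (x (S m)) <= step_integral x s m + 2 * eps * (x (S m) - r)).
    { assert (Hpiece : forall m, (m <= N)%nat ->
        RInt k (x m) (x (S m)) <= s m * (x (S m) - x m) + 2 * eps * (x (S m) - x m)).
      { intros m Hm. rewrite <- Rmult_plus_distr_r. specialize (HxR m Hm).
        specialize (Hxr m). rewrite HxS in *.
        apply RInt_pos_le_const; [easy|lra|]. intros t Ht.
        specialize (Hd (x m) t ltac:(lra) ltac:(lra) ltac:(apply Rabs_def1; lra)).
        apply Rabs_def2 in Hd. unfold s. lra. }
      induction m as [|m IH]; intros Hm.
      - replace r with (x O) at 1 2 by (unfold x; simpl; ring).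
        unfold step_integral. simpl sum_f_R0. now apply Hpiece.
      - rewrite (RInt_pos_Chasles k r (x (S m))); [|easy|lra|].
        + specialize (IH ltac:(lia)). specialize (Hpiece (S m) Hm).
          unfold step_integral in *. rewrite tech5. lra.
        + rewrite (HxS (S m)). specialize (Hxr (S m)). lra. }
    specialize (Hind N (le_n N)).
    replace (x (S N)) with R' in Hind by (unfold x; rewrite HstE; ring).
    lra. }
  apply le_epsilon. intros eps Heps.
  assert (Hp : 0 < eps / (2 * (R' - r + 1))) by (apply Rdiv_lt_0_compat; lra).
  specialize (H (mkposreal _ Hp)). simpl in H.
  eapply Rle_trans; [exact H|]. apply Rplus_le_compat_l.
  replace (2 * (eps / (2 * (R' - r + 1))) * (R' - r))
    with (eps * ((R' - r) / (R' - r + 1))) by (field; lra).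
  rewrite <- (Rmult_1_r eps) at 2. apply Rmult_le_compat_l; [lra|].
  apply (Rmult_le_reg_r (R' - r + 1)); [lra|].
  unfold Rdiv. rewrite Rmult_assoc, Rinv_l by lra. lra.
Qed.

(** A step function below the supremum of [|D|] lies below every majorant [G]: a height above [G t]
    would be witnessed by a point with [|D| > G t]. Seminorm bounds thus reduce to integrating a
    continuous majorant. *)
Lemma B0_seminorm_le_RInt (D : Cx -> Cx) (G : R -> R) (B : R) :
  (forall t, 0 < t -> continuous G t) ->
  (forall t y, 0 < t -> Cmod (D (t, y)) <= G t) ->
  (forall r R', 0 < r <= R' -> RInt G r R' <= B) ->
  B0_seminorm_le D B.
Proof.
  intros Hc HG HB x s n (Hx0 & Hx & Hs).
  assert (Hxp : forall i, (i <= S n)%nat -> x O <= x i).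
  { induction i as [|i IH]; intros Hi; [lra|].
    specialize (IH ltac:(lia)). specialize (Hx i ltac:(lia)). lra. }
  assert (Hpiece : forall m, (m <= n)%nat -> s m * (x (S m) - x m) <= RInt G (x m) (x (S m))).
  { intros m Hm. pose proof (Hxp m ltac:(lia)). pose proof (Hx m Hm).
    replace (s m * (x (S m) - x m)) with (RInt (fun _ => s m) (x m) (x (S m)))
      by (rewrite RInt_const; unfold scal; simpl; unfold mult; simpl; ring).
    apply RInt_le; [easy|apply @ex_RInt_const|apply ex_RInt_pos; [easy|lra]|].
    intros t Ht. apply Rnot_lt_le. intros Hlt.
    destruct (Hs m Hm t ltac:(lra) (G t) Hlt) as [y Hy].
    rewrite Defs_Cmod in Hy. specialize (HG t y ltac:(lra)). unfold Cmk in Hy. lra. }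
  assert (Hind : forall m, (m <= n)%nat -> step_integral x s m <= RInt G (x O) (x (S m))).
  { induction m as [|m IH]; intros Hm.
    - unfold step_integral. simpl sum_f_R0. now apply Hpiece.
    - rewrite (RInt_pos_Chasles G (x O) (x (S m))); [|easy|lra|].
      + specialize (IH ltac:(lia)). specialize (Hpiece (S m) Hm).
        unfold step_integral in *. rewrite tech5. lra.
      + split; [apply Hxp; lia|apply Hx; lia]. }
  eapply Rle_trans; [apply Hind; lia|]. apply HB. split; [easy|apply Hxp; lia].
Qed.

(** * Functions in B *)

Lemma cderiv_Cplus_minus (f g df dg : C -> C) :
  cderiv_Cplus f df -> cderiv_Cplus g dg ->
  cderiv_Cplus (fun z => f z - g z)%C (fun z => df z - dg z)%C.
Proof. intros Hf Hg x y Hx. apply is_cderive_minus; [now apply Hf|now apply Hg]. Qed.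

Lemma Cplus_pair_RtoC (x y a : R) : ((x, y) + RtoC a)%C = (x + a, y).
Proof. apply injective_projections; simpl; ring. Qed.

Lemma cderiv_Cplus_shift (a : R) (f df : C -> C) :
  0 <= a -> cderiv_Cplus f df ->
  cderiv_Cplus (fun z => f (z + RtoC a)%C) (fun z => df (z + RtoC a)%C).
Proof.
  intros Ha Hf x y Hx. apply is_cderive_shift. rewrite Cplus_pair_RtoC. apply Hf. lra.
Qed.

(** Only [|df|] on the single line through [y] is integrated. It is known to be continuous, whereas
    the regularity of the supremum over [y] depends on decay bounds that are derived from this
    lemma. *)
Lemma B_horizontal_oscillation (f df : C -> C) (b r R' y : R) :
  cderiv_Cplus f df -> B0_seminorm_le df b -> 0 < r <= R' ->
  Cmod (f (R', y) - f (r, y))%C <= 2 * b.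
Proof.
  intros Hf Hb Hr. eapply Rle_trans; [now apply (horizontal_increment f df)|].
  apply Rmult_le_compat_l; [lra|].
  apply RInt_le_B0_seminorm with df; try easy.
  - intros t Ht. apply cderiv_continuous_horizontal with f; [apply Cmod_lipschitz|easy|easy].
  - intros t _ u Hu. now exists y.
Qed.

Lemma B_deriv_small_somewhere (df : C -> C) (b x y eps : R) :
  B0_seminorm_le df b -> 0 < x -> 0 < eps ->
  exists a, 0 <= a /\ Cmod (df (x + a, y)%R) < eps.
Proof.
  intros Hb Hx Heps. apply NNPP. intros Hn.
  pose proof (B0_seminorm_nonneg df b Hb) as Hb0.
  (* If [|df|] stayed at least [eps] to the right of [x], one step of height [eps] and length [X]
     would have integral [b + 1]. *)
  set (X := (b + 1) / eps).
  assert (HX : 0 < X) by (apply Rdiv_lt_0_compat; lra).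
  assert (H : step_integral (fun n => x + INR n * X) (fun _ => eps) O <= b).
  { apply Hb. split; [simpl; lra|]. split; [intros i _; rewrite S_INR; nra|].
    intros i Hi al Hal t Ht. exists y. rewrite Defs_Cmod.
    apply Rnot_le_lt. intros Hle. apply Hn. exists (al - x).
    replace i with O in Hal by lia. simpl in Hal.
    split; [lra|]. rewrite Rplus_minus. unfold Cmk in Hle. lra. }
  unfold step_integral in H. simpl in H.
  replace (eps * (x + 1 * X - (x + 0 * X))) with (b + 1) in H; [lra|].
  unfold X. field. lra.
Qed.

(* [f] is not known to be bounded here; the differences [f - T(a) f] are, by the
   horizontal oscillation, and their derivatives recover that of [f] as [a] grows. *)
Lemma B_deriv_decay (f df : C -> C) (b : R) :
  cderiv_Cplus f df -> B0_seminorm_le df b -> deriv_decay df (2 * b).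
Proof.
  intros Hf Hb. pose proof (B0_seminorm_nonneg df b Hb) as Hb0.
  assert (HD : forall a, 0 <= a ->
    deriv_decay (fun z => df z - df (z + RtoC a))%C (2 * b)).
  { intros a Ha.
    apply deriv_decay_of_bounded with (fun z => f z - f (z + RtoC a))%C.
    - apply cderiv_Cplus_minus; [easy|now apply cderiv_Cplus_shift].
    - intros x y Hx. rewrite Cplus_pair_RtoC, Cmod_minus_sym.
      apply B_horizontal_oscillation with df; try easy. lra. }
  assert (H1 : forall x y, 0 < x -> Cmod (df (x, y)) <= 8 * (2 * b) / x).
  { intros x y Hx. apply le_epsilon. intros eps Heps.
    destruct (B_deriv_small_somewhere df b x y eps Hb Hx Heps) as [a [Ha Hs]].
    destruct (HD a Ha) as [D1 _]. specialize (D1 x y Hx).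
    rewrite Cplus_pair_RtoC in D1.
    replace (df (x, y)) with ((df (x, y) - df (x + a, y)%R) + df (x + a, y)%R)%C by ring.
    eapply Rle_trans; [apply Cmod_triangle|]. lra. }
  split; [exact H1|]. intros x y d Hx Hd.
  apply le_epsilon. intros eps Heps.
  (* Beyond [a] the first bound gives [|df| <= 16 * b / u <= eps / 2]; two such terms make up the
     [eps] to be spared. *)
  set (a := 32 * b / eps).
  assert (Ha : 0 <= a) by (apply Rdiv_le_0_compat; lra).
  destruct (HD a Ha) as [_ D2]. specialize (D2 x y d Hx Hd).
  rewrite !Cplus_pair_RtoC in D2.
  assert (Hsmall : forall u, a < u -> 8 * (2 * b) / u <= eps / 2).
  { intros u Hu. apply (Rmult_le_reg_r u); [lra|].
    unfold Rdiv at 1. rewrite Rmult_assoc, Rinv_l, Rmult_1_r by lra.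
    assert (a * eps = 32 * b) by (unfold a; field; lra). nra. }
  pose proof (H1 (x + a) y ltac:(lra)) as E1.
  pose proof (H1 (x + d + a) y ltac:(lra)) as E2.
  pose proof (Hsmall (x + a) ltac:(lra)). pose proof (Hsmall (x + d + a) ltac:(lra)).
  set (u := df (x + d, y)) in *. set (v := df (x, y)) in *.
  set (u' := df (x + d + a, y)) in *. set (v' := df (x + a, y)) in *.
  replace (u - v)%C with ((u - u' - (v - v')) + (u' - v'))%C by ring.
  eapply Rle_trans; [apply Cmod_triangle|].
  pose proof (Cmod_minus_le u' v'). lra.
Qed.

(** * The supremum of the derivative over vertical lines *)

Definition vertical_sup (df : C -> C) (x : R) : R :=
  real (Lub_Rbar (fun t => exists y, t = Cmod (df (x, y)))).

(** The decay bound [8 * M / x] makes the supremum finite. This is what gives [vertical_sup] its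
    meaning, as [real] sends infinite values to the default 0. *)
Lemma vertical_sup_lub (df : C -> C) (M x : R) :
  deriv_decay df M -> 0 < x ->
  is_lub (fun t => exists y, t = Cmod (df (x, y))) (vertical_sup df x).
Proof.
  intros [H1 _] Hx. unfold vertical_sup.
  set (E := fun t => exists y, t = Cmod (df (x, y))).
  destruct (Lub_Rbar_correct E) as [Hub Hl].
  assert (HK : is_ub_Rbar E (8 * M / x)) by (intros t [y ->]; now apply H1).
  pose proof (Hl _ HK) as Hle.
  assert (H0 : E (Cmod (df (x, 0)))) by now exists 0.
  pose proof (Hub _ H0) as Hge.
  destruct (Lub_Rbar E) as [m| |]; try easy. split.
  - intros t Ht. exact (Hub t Ht).
  - intros c Hc. apply (Hl (Finite c)). intros t Ht. now apply Hc.
Qed.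

Lemma vertical_sup_ub (df : C -> C) (M x y : R) :
  deriv_decay df M -> 0 < x -> Cmod (df (x, y)) <= vertical_sup df x.
Proof.
  intros H Hx. apply (vertical_sup_lub df M x H Hx). now exists y.
Qed.

Lemma vertical_sup_le (df : C -> C) (M x c : R) :
  deriv_decay df M -> 0 < x -> (forall y, Cmod (df (x, y)) <= c) -> vertical_sup df x <= c.
Proof.
  intros H Hx Hc. apply (vertical_sup_lub df M x H Hx). now intros t [y ->].
Qed.

Lemma vertical_sup_lt (df : C -> C) (M x u : R) :
  deriv_decay df M -> 0 < x -> u < vertical_sup df x -> exists y, u < Cmod (df (x, y)).
Proof.
  intros H Hx Hu. apply NNPP. intros Hn.
  assert (vertical_sup df x <= u); [|lra].
  apply vertical_sup_le with M; try easy. intros y. apply Rnot_lt_le. intros Hlt.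
  apply Hn. now exists y.
Qed.

Lemma vertical_sup_ge_0 (df : C -> C) (M x : R) :
  deriv_decay df M -> 0 < x -> 0 <= vertical_sup df x.
Proof.
  intros H Hx. eapply Rle_trans; [apply Cmod_ge_0|].
  now apply vertical_sup_ub with (M := M) (y := 0).
Qed.

(** The second decay bound is uniform in [y], and a supremum of functions with a common modulus of
    continuity keeps that modulus. *)
Lemma vertical_sup_lipschitz (df : C -> C) (M x d : R) :
  deriv_decay df M -> 0 < x -> 0 <= d ->
  Rabs (vertical_sup df (x + d) - vertical_sup df x) <= 64 * M * d / (x * x).
Proof.
  intros H Hx Hd.
  assert (HL : forall y, Rabs (Cmod (df (x + d, y)%R)%C - Cmod (df (x, y)))
    <= 64 * M * d / (x * x)).
  { intros y. eapply Rle_trans; [apply Cmod_lipschitz|]. now apply H. }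
  apply Rabs_le. split.
  - assert (vertical_sup df x <= vertical_sup df (x + d) + 64 * M * d / (x * x)); [|lra].
    apply vertical_sup_le with M; try easy. intros y. specialize (HL y).
    apply Rabs_le_between in HL.
    pose proof (vertical_sup_ub df M (x + d) y H ltac:(lra)). lra.
  - assert (vertical_sup df (x + d) <= vertical_sup df x + 64 * M * d / (x * x)); [|lra].
    apply vertical_sup_le with M; [easy|lra|]. intros y. specialize (HL y).
    apply Rabs_le_between in HL.
    pose proof (vertical_sup_ub df M x y H ltac:(lra)). lra.
Qed.

Lemma vertical_sup_continuous (df : C -> C) (M : R) :
  deriv_decay df M -> forall x, 0 < x -> continuous (vertical_sup df) x.
Proof.
  intros H x Hx.
  assert (HM : 0 <= M).
  (* At abscissa 8 the first bound reads [Cmod (df (8, 0)) <= M]. *)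
  { destruct H as [H _]. specialize (H 8 0 ltac:(lra)). pose proof (Cmod_ge_0 (df (8, 0))). lra. }
  apply continuous_of_local_lipschitz with (64 * M / (x / 2 * (x / 2))) (x / 2); [lra|].
  (* The Lipschitz bound is based at the left of the two points. For negative [e] this is
     [x + e >= x / 2], which explains the constant with [x / 2]. *)
  intros e He. apply Rabs_le_between in He.
  assert (Hmono : forall u, x / 2 <= u ->
    64 * M * Rabs e / (u * u) <= 64 * M / (x / 2 * (x / 2)) * Rabs e).
  { intros u Hu.
    replace (64 * M / (x / 2 * (x / 2)) * Rabs e)
      with (64 * M * Rabs e * / (x / 2 * (x / 2))) by (field; lra).
    apply Rmult_le_compat_l; [pose proof (Rabs_pos e); nra|].
    apply Rinv_le_contravar; nra. }
  destruct (Rle_dec 0 e) as [H0|H0].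
  - rewrite (Rabs_right e) in * by lra.
    eapply Rle_trans; [now apply vertical_sup_lipschitz with (M := M)|]. apply Hmono. lra.
  - rewrite (Rabs_left e) in * by lra. rewrite Rabs_minus_sym.
    pose proof (vertical_sup_lipschitz df M (x + e) (- e) H ltac:(lra) ltac:(lra)) as L.
    replace (x + e + - e) with x in L by ring.
    eapply Rle_trans; [exact L|]. apply Hmono. lra.
Qed.

(** Take [[r0, R0]] whose integral is within [eps] of the supremum of all such integrals. An
    interval to its left or right with integral above [eps] would push the total beyond that
    supremum. *)
Lemma RInt_small_at_ends (g : R -> R) (b eps : R) :
  (forall t, 0 < t -> continuous g t) -> (forall t, 0 < t -> 0 <= g t) ->
  (forall r R', 0 < r <= R' -> RInt g r R' <= b) -> 0 < eps ->
  exists r0 R0, 0 < r0 <= R0 /\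
    forall r R', 0 < r <= R' -> R' <= r0 \/ R0 <= r -> RInt g r R' <= eps.
Proof.
  intros Hc Hg Hb Heps.
  destruct (completeness (fun t => exists r R', 0 < r <= R' /\ t = RInt g r R'))
    as [S [HS1 HS2]].
  { exists b. intros t (r & R' & Hr & ->). now apply Hb. }
  { exists (RInt g 1 1), 1, 1. split; [lra|easy]. }
  assert (Hex : exists r0 R0, 0 < r0 <= R0 /\ S - eps < RInt g r0 R0).
  { apply NNPP. intros Hn. assert (S <= S - eps); [|lra].
    apply HS2. intros t (r & R' & Hr & ->). apply Rnot_lt_le. intros Hlt.
    apply Hn. now exists r, R'. }
  destruct Hex as (r0 & R0 & H0 & Hlt). exists r0, R0. split; [easy|].
  assert (Hpos : forall r R', 0 < r <= R' -> 0 <= RInt g r R').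
  { intros r R' Hr. apply RInt_ge_0; [lra|now apply ex_RInt_pos|].
    intros t Ht. apply Hg. lra. }
  assert (HS : forall r R', 0 < r <= R' -> RInt g r R' <= S).
  { intros r R' Hr. apply HS1. now exists r, R'. }
  intros r R' Hr [Hl|Hl].
  - pose proof (HS r R0 ltac:(lra)) as E.
    rewrite (RInt_pos_Chasles g r R' R0), (RInt_pos_Chasles g R' r0 R0) in E by (easy || lra).
    pose proof (Hpos R' r0 ltac:(lra)). lra.
  - pose proof (HS r0 R' ltac:(lra)) as E.
    rewrite (RInt_pos_Chasles g r0 R0 R'), (RInt_pos_Chasles g R0 r R') in E by (easy || lra).
    pose proof (Hpos R0 r ltac:(lra)). lra.
Qed.

Lemma horizontal_increment_sup (f df : C -> C) (M r R' y : R) :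
  cderiv_Cplus f df -> deriv_decay df M -> 0 < r <= R' ->
  Cmod (f (R', y) - f (r, y))%C <= 2 * RInt (vertical_sup df) r R'.
Proof.
  intros Hf HM Hr. eapply Rle_trans; [now apply (horizontal_increment f df)|].
  apply Rmult_le_compat_l; [lra|]. apply RInt_le; [lra| | |].
  - apply ex_RInt_pos; [|easy]. intros t Ht.
    apply cderiv_continuous_horizontal with f; [apply Cmod_lipschitz|easy|easy].
  - apply ex_RInt_pos; [|easy]. now apply vertical_sup_continuous with M.
  - intros t Ht. apply vertical_sup_ub with M; [easy|lra].
Qed.

(** * Vertical increments and the limit at infinity *)

Lemma vertical_increment_fst (f df : C -> C) (x y K : R) :
  cderiv_Cplus f df -> 0 < x -> (forall t, Cmod (df (x, t)) <= K) ->
  Rabs (fst (f (x, y)) - fst (f (x, 0))) <= K * Rabs y.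
Proof.
  intros Hf Hx HK.
  (* A uniform bound on the vertical line is at hand, so the mean value theorem does the work that
     integration does on horizontal lines. *)
  destruct (MVT_gen (fun t => fst (f (x, t))) 0 y (fun t => fst (df (x, t) * Ci)%C))
    as [c [_ Hc]].
  - intros t _. apply (is_derive_along f (fun s => (x, s))).
    + apply Cmod_Ci.
    + intros h. apply injective_projections; simpl; ring.
    + now apply Hf.
  - intros t _. apply continuity_pt_filterlim.
    apply (continuous_along f (fun s => (x, s)) fst t (df (x, t))).
    + intros s. apply vertical_lipschitz.
    + apply fst_lipschitz.
    + now apply Hf.
  - rewrite Hc, Rabs_mult, Rminus_0_r. apply Rmult_le_compat_r; [apply Rabs_pos|].
    eapply Rle_trans; [apply fst_le_Cmod|]. rewrite Cmod_mult, Cmod_Ci, Rmult_1_r. apply HK.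
Qed.

Lemma vertical_increment (f df : C -> C) (x y K : R) :
  cderiv_Cplus f df -> 0 < x -> (forall t, Cmod (df (x, t)) <= K) ->
  Cmod (f (x, y) - f (x, 0%R))%C <= 2 * (K * Rabs y).
Proof.
  intros Hf Hx HK.
  pose proof (vertical_increment_fst f df x y K Hf Hx HK) as H1.
  pose proof (vertical_increment_fst _ _ x y K (cderiv_Cplus_scal Ci f df Hf) Hx) as H2.
  specialize (H2 ltac:(intros t; cbv beta; rewrite Cmod_mult, Cmod_Ci, Rmult_1_l; apply HK)). cbv beta in H2.
  eapply Rle_trans; [apply Cmod_le_fst_snd|].
  replace (fst (Ci * f (x, y))%C - fst (Ci * f (x, 0%R))%C)
    with (- snd (f (x, y) - f (x, 0%R))%C) in H2 by (simpl; ring).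
  rewrite Rabs_Ropp in H2. simpl in *. unfold Rminus in H1. lra.
Qed.

Definition tends_at_infty (f : C -> C) (l : C) : Prop :=
  forall eps, 0 < eps -> exists X, forall x y, X < x -> Cmod (f (x, y) - l)%C < eps.

Lemma vertical_sup_RInt_le (df : C -> C) (M b r R' : R) :
  deriv_decay df M -> B0_seminorm_le df b -> 0 < r <= R' ->
  RInt (vertical_sup df) r R' <= b.
Proof.
  intros HM Hb Hr. apply RInt_le_B0_seminorm with df; try easy.
  - now apply vertical_sup_continuous with M.
  - intros t Ht u Hu. now apply vertical_sup_lt with M.
Qed.

Lemma vertical_sup_small_at_ends (f df : C -> C) (b eps : R) :
  cderiv_Cplus f df -> B0_seminorm_le df b -> 0 < eps ->
  exists r0 R0, 0 < r0 <= R0 /\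
    forall r R', 0 < r <= R' -> R' <= r0 \/ R0 <= r -> RInt (vertical_sup df) r R' <= eps.
Proof.
  intros Hf Hb Heps. pose proof (B_deriv_decay f df b Hf Hb) as HM.
  apply RInt_small_at_ends with b; try easy.
  - now apply vertical_sup_continuous with (2 * b).
  - intros t Ht. now apply vertical_sup_ge_0 with (2 * b).
  - intros r R' Hr. now apply vertical_sup_RInt_le with (2 * b).
Qed.

(** Horizontal oscillation beyond [R0] is small uniformly in [y], so [f(n, 0)] is Cauchy. Another
    height is reached by moving out to abscissa [n], then vertically to the real axis; the vertical
    move is cheap because [|df|] is of order [1 / n] there. *)
Lemma B_tends_at_infty (f df : C -> C) (b : R) :
  cderiv_Cplus f df -> B0_seminorm_le df b -> exists l, tends_at_infty f l.
Proof.
  intros Hf Hb. pose proof (B_deriv_decay f df b Hf Hb) as HM.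
  pose proof (B0_seminorm_nonneg df b Hb) as Hb0.
  assert (Hosc : forall eps, 0 < eps -> exists R0, 0 < R0 /\
    forall r R' y, R0 <= r -> R0 <= R' -> Cmod (f (R', y) - f (r, y))%C <= eps).
  { intros eps Heps.
    destruct (vertical_sup_small_at_ends f df b (eps / 2) Hf Hb) as (r0 & R0 & H0 & Hs);
      [lra|].
    exists R0. split; [lra|].
    assert (Hle : forall r R' y, R0 <= r -> r <= R' -> Cmod (f (R', y) - f (r, y))%C <= eps).
    { intros r R' y H1 H2.
      pose proof (horizontal_increment_sup f df (2 * b) r R' y Hf HM ltac:(lra)).
      pose proof (Hs r R' ltac:(lra) ltac:(lra)). lra. }
    intros r R' y H1 H2. destruct (Rle_dec r R'); [now apply Hle|].
    rewrite Cmod_minus_sym. apply Hle; lra. }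
  assert (Hseq : forall phi : C -> R, (forall a c, Rabs (phi a - phi c) <= Cmod (a - c)%C) ->
    exists l, Un_cv (fun n => phi (f (INR n, 0))) l).
  { intros phi Hphi. destruct (Rcomplete.R_complete (fun n => phi (f (INR n, 0)))) as [l Hl];
      [|now exists l].
    intros eps Heps. destruct (Hosc (eps / 2) ltac:(lra)) as [R0 [HR0 Ho]].
    destruct (INR_archimed 1 R0 Rlt_0_1) as [N HN]. exists N. intros n m Hn Hm.
    apply le_INR in Hn, Hm. unfold Rdist. eapply Rle_lt_trans; [apply Hphi|].
    specialize (Ho (INR m) (INR n) 0 ltac:(lra) ltac:(lra)). lra. }
  destruct (Hseq fst fst_lipschitz) as [l1 Hl1].
  destruct (Hseq snd snd_lipschitz) as [l2 Hl2].
  exists (l1, l2). intros eps Heps.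
  destruct (Hosc (eps / 5) ltac:(lra)) as [R0 [HR0 Ho]].
  exists R0. intros x y Hx.
  destruct (Hl1 (eps / 5) ltac:(lra)) as [N1 HN1].
  destruct (Hl2 (eps / 5) ltac:(lra)) as [N2 HN2].
  destruct (INR_archimed 1 R0 Rlt_0_1) as [N3 HN3].
  (* The auxiliary abscissa [n] may depend on [y], while the threshold [R0] does not, so the limit
     is uniform in [y]. The errors are four times [eps / 5], which leaves the inequality strict. *)
  destruct (INR_archimed (eps / 5) (32 * b * Rabs y) ltac:(lra)) as [N4 HN4].
  set (n := (N1 + N2 + N3 + N4)%nat).
  assert (INR N3 <= INR n) by (apply le_INR; unfold n; lia).
  assert (INR N4 <= INR n) by (apply le_INR; unfold n; lia).
  specialize (HN1 n ltac:(unfold n; lia)). specialize (HN2 n ltac:(unfold n; lia)).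
  unfold Rdist in HN1, HN2.
  pose proof (Ho (INR n) x y ltac:(lra) ltac:(lra)) as E1.
  pose proof (vertical_increment f df (INR n) y (8 * (2 * b) / INR n) Hf ltac:(lra)) as E2.
  specialize (E2 ltac:(intros t; apply HM; lra)).
  assert (E3 : Cmod (f (INR n, 0%R) - (l1, l2))%C <= eps / 5 + eps / 5).
  { eapply Rle_trans; [apply Cmod_le_fst_snd|]. simpl. unfold Rminus in HN1, HN2. lra. }
  assert (E4 : 2 * (8 * (2 * b) / INR n * Rabs y) <= eps / 5).
  { replace (2 * (8 * (2 * b) / INR n * Rabs y)) with (32 * b * Rabs y / INR n)
      by (field; lra).
    apply (Rmult_le_reg_r (INR n)); [lra|].
    unfold Rdiv at 1. rewrite Rmult_assoc, Rinv_l by lra. nra. }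
  replace (f (x, y) - (l1, l2))%C
    with ((f (x, y) - f (INR n, y)) + ((f (INR n, y) - f (INR n, 0%R)) + (f (INR n, 0%R) - (l1, l2))))%C
    by ring.
  eapply Rle_lt_trans; [apply Cmod_triangle|].
  pose proof (Cmod_triangle (f (INR n, y) - f (INR n, 0%R)) (f (INR n, 0%R) - (l1, l2))).
  lra.
Qed.

(** * Approximation by differences of shifts *)

Lemma is_cderive_ext (f g : C -> C) (z l : C) :
  (forall t, f t = g t) -> is_cderive f z l -> is_cderive g z l.
Proof.
  intros E H eps Heps. destruct (H eps Heps) as [d [Hd Hb]]. exists d. split; [easy|].
  intros h Hh. rewrite <- !E. now apply Hb.
Qed.

Lemma continuous_inv_sq (K a t : R) :
  0 < t + a -> continuous (fun s => K / ((s + a) * (s + a))) t.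
Proof. intros H. apply @ex_derive_continuous. auto_derive. repeat split; nra. Qed.

Lemma RInt_inv_sq_le (K a r R' : R) :
  0 <= K -> 0 <= a -> 0 < r <= R' ->
  RInt (fun t => K / ((t + a) * (t + a))) r R' <= K / (r + a).
Proof.
  intros HK Ha Hr.
  assert (H : is_RInt (fun t => K / ((t + a) * (t + a))) r R'
    (minus (- K / (R' + a)) (- K / (r + a)))).
  { apply (is_RInt_derive (V := R_CompleteNormedModule) (fun t => - K / (t + a)));
      intros t Ht; rewrite Rmin_left, Rmax_right in Ht by lra.
    - auto_derive; [lra|]. field. lra.
    - apply continuous_inv_sq. lra. }
  rewrite (is_RInt_unique _ _ _ _ H). unfold minus, plus, opp; simpl.
  assert (0 <= K / (R' + a)) by (apply Rdiv_le_0_compat; lra).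
  replace (- K / (R' + a) + - (- K / (r + a))) with (K / (r + a) - K / (R' + a))
    by (field; lra).
  lra.
Qed.

Lemma continuous_shift (g : R -> R) (a t : R) :
  continuous g (t + a) -> continuous (fun s => g (s + a)) t.
Proof.
  intros H. apply (continuous_comp (fun s => s + a) g); [|exact H].
  apply @ex_derive_continuous. now auto_derive.
Qed.

Lemma RInt_shift (g : R -> R) (a r R' : R) :
  (forall t, 0 < t -> continuous g t) -> 0 <= a -> 0 < r <= R' ->
  RInt (fun t => g (t + a)) r R' = RInt g (r + a) (R' + a).
Proof.
  intros Hg Ha Hr. pose proof (RInt_comp_lin g 1 a r R') as H.
  rewrite !Rmult_1_l in H.
  rewrite <- H by (apply ex_RInt_pos; [easy|lra]).
  apply RInt_ext. intros t _.
  change (g (t + a) = 1 * g (1 * t + a)). now rewrite !Rmult_1_l.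
Qed.

Lemma continuous_Rmin (f g : R -> R) (t : R) :
  continuous f t -> continuous g t -> continuous (fun s => Rmin (f s) (g s)) t.
Proof.
  intros Hf Hg.
  apply continuous_ext with (fun s => (f s + g s + - Rabs (f s + - g s)) * / 2).
  { intros s. unfold Rmin. destruct (Rle_dec (f s) (g s)) as [H|H].
    - rewrite Rabs_left1 by lra. lra.
    - rewrite Rabs_right by lra. lra. }
  apply (continuous_mult (K := R_AbsRing)); [|apply continuous_const].
  apply (continuous_plus (V := R_NormedModule)).
  - now apply (continuous_plus (V := R_NormedModule)).
  - apply (continuous_opp (V := R_NormedModule)). apply continuous_Rabs_comp.
    apply (continuous_plus (V := R_NormedModule)); [easy|].
    now apply (continuous_opp (V := R_NormedModule)).
Qed.

(** Majorant of [|f'(t + iy) - f'(t + a + iy)|]. The first entry is integrable near 0, the second is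
    small away from 0 when [a] is small. The form [t + 0] makes the second entry an instance of the
    [t + a] pattern of the inverse square lemmas. *)
Definition shift_majorant (g : R -> R) (M a t : R) : R :=
  Rmin (g t + g (t + a)) (64 * M * a / ((t + 0) * (t + 0))).

Lemma shift_majorant_continuous (g : R -> R) (M a t : R) :
  (forall t, 0 < t -> continuous g t) -> 0 <= a -> 0 < t ->
  continuous (shift_majorant g M a) t.
Proof.
  intros Hc Ha Ht. apply continuous_Rmin.
  - apply (continuous_plus (V := R_NormedModule)); [now apply Hc|].
    apply continuous_shift, Hc. lra.
  - apply continuous_inv_sq. lra.
Qed.

(** Split at [r0 / 2]. Below it, [t] and [t + a] both stay in the range where [g] has integral at
    most [e], which costs [2 * e]; above it the inverse square integrates to at most
    [64 * M * a / (r0 / 2) <= e]. *)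
Lemma RInt_shift_majorant_le (g : R -> R) (M e r0 a r R' : R) :
  (forall t, 0 < t -> continuous g t) -> 0 <= M -> 0 < e -> 0 < r0 ->
  (forall r R', 0 < r <= R' -> R' <= r0 -> RInt g r R' <= e) ->
  0 <= a <= r0 / 2 -> 64 * M * a / (r0 / 2) <= e -> 0 < r <= R' ->
  RInt (shift_majorant g M a) r R' <= 3 * e.
Proof.
  intros Hc HM He Hr0 Hsmall Ha Hae Hr.
  assert (Hcm : forall t, 0 < t -> continuous (shift_majorant g M a) t)
    by (intros t Ht; apply shift_majorant_continuous; easy || lra).
  assert (Hlow : forall r R', 0 < r <= R' -> R' <= r0 / 2 ->
    RInt (shift_majorant g M a) r R' <= 2 * e).
  { intros s S Hs HS.
    assert (Hcs : forall t, 0 < t -> continuous (fun t => g (t + a)) t)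
      by (intros t Ht; apply continuous_shift, Hc; lra).
    assert (E : RInt (fun t => g t + g (t + a)) s S = RInt g s S + RInt g (s + a) (S + a)).
    { rewrite <- RInt_shift by (easy || lra).
      apply (RInt_plus (V := R_CompleteNormedModule) g (fun t => g (t + a)));
        now apply ex_RInt_pos. }
    apply (Rle_trans _ (RInt (fun t => g t + g (t + a)) s S)).
    - apply RInt_le; [lra|now apply ex_RInt_pos| |intros t _; apply Rmin_l].
      apply ex_RInt_pos; [|easy]. intros t Ht.
      apply (continuous_plus (V := R_NormedModule)); auto.
    - rewrite E. pose proof (Hsmall s S Hs ltac:(lra)).
      pose proof (Hsmall (s + a) (S + a) ltac:(lra) ltac:(lra)). lra. }
  assert (Hhigh : forall r R', r0 / 2 <= r -> r <= R' ->
    RInt (shift_majorant g M a) r R' <= e).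
  { intros s S Hs HS.
    apply (Rle_trans _ (RInt (fun t => 64 * M * a / ((t + 0) * (t + 0))) s S)).
    - apply RInt_le; [lra|apply ex_RInt_pos; [easy|lra]| |intros t _; apply Rmin_r].
      apply ex_RInt_pos; [|lra]. intros t Ht. apply continuous_inv_sq. lra.
    - eapply Rle_trans; [apply RInt_inv_sq_le; nra|]. eapply Rle_trans; [|exact Hae].
      apply Rmult_le_compat_l; [nra|]. apply Rinv_le_contravar; lra. }
  destruct (Rle_dec R' (r0 / 2)) as [H1|H1].
  - specialize (Hlow r R' Hr H1). lra.
  - destruct (Rle_dec (r0 / 2) r) as [H2|H2].
    + specialize (Hhigh r R' H2 ltac:(lra)). lra.
    + rewrite (RInt_pos_Chasles _ r (r0 / 2)) by (easy || lra).
      specialize (Hlow r (r0 / 2) ltac:(lra) ltac:(lra)).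
      specialize (Hhigh (r0 / 2) R' ltac:(lra) ltac:(lra)). lra.
Qed.

(** Subtraction is spelled as adding a multiple by [(-1, 0)], literally in the form of the closure
    conditions of [is_subspace], so that membership follows without function extensionality. *)
Definition shift_combination (a c : R) (l : Cx) (y : Cx -> Cx) : Cx -> Cx :=
  fun z => Cadd (Cadd (shift a y z) (Cmul (-1, 0) (shift c y z))) l.

Lemma Fsub_shift_combination (f y : C -> C) (a c : R) (l z : C) :
  Fsub f (shift_combination a c l y) z
  = (f z - (y (z + RtoC a) - y (z + RtoC c)) - l)%C.
Proof.
  unfold Fsub, shift_combination, shift.
  change (Cadd z (Defs.RtoC a)) with (z + RtoC a)%C.
  change (Cadd z (Defs.RtoC c)) with (z + RtoC c)%C.
  apply injective_projections; simpl; unfold Defs.Re, Defs.Im; simpl; ring.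
Qed.

Lemma choose_below (K e A : R) :
  0 <= K -> 0 < e -> 0 < A -> exists a, 0 < a <= A /\ K * a <= e.
Proof.
  intros HK He HA. exists (Rmin A (e / (K + 1))).
  assert (0 < e / (K + 1)) by (apply Rdiv_lt_0_compat; lra).
  pose proof (Rmin_l A (e / (K + 1))). pose proof (Rmin_r A (e / (K + 1))).
  assert (0 < Rmin A (e / (K + 1))) by now apply Rmin_pos.
  assert ((K + 1) * (e / (K + 1)) = e) by (field; lra).
  split; [lra|]. nra.
Qed.

(** The order of quantifiers is the point: [a], [c] and [eta] depend on [f] and [eps] only, so [y]
    can be picked from the sup norm closure afterwards. *)
Lemma B_shift_approximation (f df : C -> C) (b eps : R) (l : C) :
  cderiv_Cplus f df -> B0_seminorm_le df b -> tends_at_infty f l -> 0 < eps ->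
  exists a c eta, 0 <= a /\ 0 <= c /\ 0 < eta /\
    forall y dy, cderiv_Cplus y dy ->
      (forall x t, 0 < x -> Cmod (f (x, t) - y (x, t)) <= eta) ->
      B_norm_le (Fsub f (shift_combination a c l y)) eps.
Proof.
  (* The sup norm will cost [2 e + e + e] and the seminorm [3 e + e + e], in all nine parts. *)
  intros Hf Hb Hl Heps. set (e := eps / 9). assert (He : 0 < e) by (unfold e; lra).
  pose proof (B0_seminorm_nonneg df b Hb) as Hb0.
  pose proof (B_deriv_decay f df b Hf Hb) as HM. set (M := 2 * b) in *.
  assert (HM0 : 0 <= M) by (unfold M; lra).
  destruct (vertical_sup_small_at_ends f df b e Hf Hb He) as (r0 & R0 & H0 & Hs).
  set (g := vertical_sup df) in *.
  assert (Hg : forall t, 0 < t -> continuous g t) by now apply vertical_sup_continuous with M.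
  destruct (Hl e He) as [X HX].
  (* The condition [a <= r0 / 2] keeps [t + a] below [r0] for [t <= r0 / 2]; the product bound makes
     the inverse square part of the majorant integrate to at most [e]. *)
  destruct (choose_below (128 * M / r0) e (r0 / 2)) as [a [Ha Hae]];
    [apply Rdiv_le_0_compat; lra|lra|lra|].
  assert (Hae' : 64 * M * a / (r0 / 2) <= e).
  { replace (64 * M * a / (r0 / 2)) with (128 * M / r0 * a) by (field; lra). exact Hae. }
  (* As [a > 0], the abscissa [c] lies beyond [R0], where the tail of [g] is small, and beyond [X],
     where [f] is within [e] of [l]. *)
  set (d := Rmax R0 (Rabs X)). set (c := a + d).
  assert (Hd : R0 <= d) by apply Rmax_l.
  assert (HdX : X <= d) by (eapply Rle_trans; [apply Rle_abs|apply Rmax_r]).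
  (* The factor [64 * d / a] bounds the seminorm of [T(a) - T(c)] relative to the sup norm;
     [eta <= e / 2] serves the two values of [f - y] in the sup norm. *)
  destruct (choose_below (64 * d / a) e (e / 2)) as [eta [Heta Hetae]];
    [apply Rdiv_le_0_compat; lra|lra|lra|].
  exists a, c, eta. repeat split; try (unfold c; lra).
  intros y dy Hy Hfy.
  pose (D := fun z => (df z - (dy (z + RtoC a) - dy (z + RtoC c)) - 0)%C).
  exists D, (4 * e), (5 * e). repeat split.
  - apply is_deriv_on_Cplus_iff. intros x t Hx.
    apply is_cderive_ext with (fun z => f z - (y (z + RtoC a) - y (z + RtoC c)) - l)%C.
    { intros z. symmetry. apply Fsub_shift_combination. }
    apply is_cderive_minus; [|apply is_cderive_const].
    apply is_cderive_minus; [now apply Hf|].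
    apply is_cderive_minus; apply is_cderive_shift; rewrite Cplus_pair_RtoC;
      apply Hy; unfold c; lra.
  - intros [x t] Hx. unfold in_Cplus, Defs.Re in Hx. simpl in Hx.
    rewrite Defs_Cmod, Fsub_shift_combination, !Cplus_pair_RtoC.
    assert (E1 : Cmod (f (x + a, t)%R - f (x, t)) <= 2 * e).
    { eapply Rle_trans; [apply (horizontal_increment_sup f df M); try easy; lra|].
      apply Rmult_le_compat_l; [lra|].
      (* Either the whole segment lies in the range where [g] has small integral, or [x > r0 / 2]
         and [g] is bounded by [8 * M / (r0 / 2)] on a segment of length [a]. *)
      destruct (Rle_dec (x + a) r0) as [Hle|Hgt].
      - apply Hs; lra.
      - apply Rle_trans with (8 * M / (r0 / 2) * (x + a - x)).
        + apply RInt_pos_le_const; [easy|lra|]. intros s Hs'.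
          apply vertical_sup_le with M; [easy|lra|]. intros w.
          eapply Rle_trans; [apply HM; lra|].
          apply Rmult_le_compat_l; [lra|]. apply Rinv_le_contravar; lra.
        + replace (8 * M / (r0 / 2) * (x + a - x)) with (64 * M * a / (r0 / 2) / 8)
            by (field; lra).
          lra. }
    assert (E2 : Cmod (f (x + c, t)%R - l) <= e)
      by (apply Rlt_le, HX; unfold c; lra).
    pose proof (Hfy (x + a) t ltac:(lra)) as E3.
    pose proof (Hfy (x + c) t ltac:(unfold c; lra)) as E4.
    rewrite Cmod_minus_sym in E1.
    replace (f (x, t) - (y (x + a, t)%R - y (x + c, t)%R) - l)%C
      with ((f (x, t) - f (x + a, t)%R) + (f (x + c, t)%R - l)
            + ((f (x + a, t)%R - y (x + a, t)%R) - (f (x + c, t)%R - y (x + c, t)%R)))%C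
      by ring.
    eapply Rle_trans; [apply Cmod_triangle|].
    eapply Rle_trans; [apply Rplus_le_compat; [apply Cmod_triangle|apply Cmod_minus_le]|].
    lra.
  (* Cauchy's bounds for [f - y] have constant [eta]. Applied between abscissas [t + a] and [t + c]
     they give [K / (t + a)^2], whose integral over the half-line is at most [K / a] thanks to
     [a > 0]. *)
  - assert (HDh : deriv_decay (fun z => df z - dy z)%C eta).
    { apply deriv_decay_of_bounded with (fun z => f z - y z)%C; [|easy].
      now apply cderiv_Cplus_minus. }
    set (K := 64 * eta * d).
    assert (HK : 0 <= K) by (unfold K; nra).
    pose (G2 := fun t => g (t + c)). pose (G3 := fun t => K / ((t + a) * (t + a))).
    assert (C1 : forall t, 0 < t -> continuous (shift_majorant g M a) t)
      by (intros t Ht; apply shift_majorant_continuous; easy || lra).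
    assert (C2 : forall t, 0 < t -> continuous G2 t)
      by (intros t Ht; apply continuous_shift, Hg; unfold c; lra).
    assert (C3 : forall t, 0 < t -> continuous G3 t)
      by (intros t Ht; apply continuous_inv_sq; lra).
    assert (C23 : forall t, 0 < t -> continuous (fun t => G2 t + G3 t) t)
      by (intros t Ht; apply (continuous_plus (V := R_NormedModule)); auto).
    apply B0_seminorm_le_RInt with (fun t => shift_majorant g M a t + (G2 t + G3 t)).
    + intros t Ht. apply (continuous_plus (V := R_NormedModule)); auto.
    + intros x t Hx. unfold D. rewrite !Cplus_pair_RtoC.
      replace (df (x, t) - (dy (x + a, t)%R - dy (x + c, t)%R) - 0)%C
        with ((df (x, t) - df (x + a, t)%R)
              + (df (x + c, t)%R
                 + - ((df (x + c, t)%R - dy (x + c, t)%R) - (df (x + a, t)%R - dy (x + a, t)%R))))%C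
        by ring.
      eapply Rle_trans; [apply Cmod_triangle|]. apply Rplus_le_compat.
      * apply Rmin_glb.
        { eapply Rle_trans; [apply Cmod_minus_le|].
          apply Rplus_le_compat; apply vertical_sup_ub with M; easy || lra. }
        { rewrite Cmod_minus_sym, Rplus_0_r. apply HM; lra. }
      * eapply Rle_trans; [apply Cmod_triangle|]. rewrite Cmod_opp. apply Rplus_le_compat.
        { apply vertical_sup_ub with M; [easy|unfold c; lra]. }
        { destruct HDh as [_ HDh]. specialize (HDh (x + a) t d ltac:(lra) ltac:(lra)).
          rewrite Rplus_assoc in HDh. exact HDh. }
    + intros r R' Hr.
      assert (I1 : RInt (shift_majorant g M a) r R' <= 3 * e).
      { apply RInt_shift_majorant_le with r0; try easy; try lra.
        intros s S HsS HS. apply Hs; lra. }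
      assert (I2 : RInt G2 r R' <= e).
      { unfold G2. rewrite RInt_shift by (easy || (unfold c; lra)).
        apply Hs; unfold c; lra. }
      assert (I3 : RInt G3 r R' <= e).
      { eapply Rle_trans; [apply RInt_inv_sq_le; easy || lra|].
        apply Rle_trans with (K / a).
        - apply Rmult_le_compat_l; [easy|]. apply Rinv_le_contravar; lra.
        - replace (K / a) with (64 * d / a * eta) by (unfold K; field; lra). exact Hetae. }
      assert (P1 : RInt (fun t => G2 t + G3 t) r R' = RInt G2 r R' + RInt G3 r R').
      { apply (RInt_plus (V := R_CompleteNormedModule) G2 G3); now apply ex_RInt_pos. }
      assert (P2 : RInt (fun t => shift_majorant g M a t + (G2 t + G3 t)) r R'
        = RInt (shift_majorant g M a) r R' + RInt (fun t => G2 t + G3 t) r R').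
      { apply (RInt_plus (V := R_CompleteNormedModule) (shift_majorant g M a)
          (fun t => G2 t + G3 t)); now apply ex_RInt_pos. }
      rewrite P2, P1. lra.
  - unfold e. lra.
Qed.

(** Only the one constant [l = f(oo)] has to lie in the subspace. This covers both cases of the
    theorem: [l = 0] for functions in B_0, and an arbitrary limit when all constants are
    available. *)
Lemma B_closure_of_Hinf_closure (Z : (Cx -> Cx) -> Prop) (f : Cx -> Cx) (l : Cx) :
  is_subspace Z -> shift_invariant Z -> (forall y, Z y -> in_B y) ->
  Z (fun _ => l) -> in_B f -> tends_at_infty f l -> Hinf_closure Z f -> B_closure Z f.
Proof.
  intros (_ & Hadd & Hmul) Hshift HZ Hconst (df & Hf & b & Hb) Hl Hcl eps Heps.
  apply is_deriv_on_Cplus_iff in Hf.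
  destruct (B_shift_approximation f df b eps l Hf Hb Hl Heps)
    as (a & c & eta & Ha & Hc & Heta & H).
  destruct (Hcl eta Heta) as [y [Hy Hfy]].
  exists (shift_combination a c l y). split.
  - unfold shift_combination.
    apply (Hadd (fun z => Cadd (shift a y z) (Cmul (-1, 0) (shift c y z))) (fun _ => l));
      [|exact Hconst].
    apply (Hadd (shift a y) (fun z => Cmul (-1, 0) (shift c y z))).
    + now apply Hshift.
    + apply Hmul. now apply Hshift.
  - destruct (HZ y Hy) as (dy & Hdy & _). apply is_deriv_on_Cplus_iff in Hdy.
    apply (H y dy Hdy). intros x t Hx. specialize (Hfy (x, t) Hx).
    rewrite Defs_Cmod in Hfy. exact Hfy.
Qed.

(** The seminorm part of the B-norm is nonnegative, so the B-norm dominates the sup norm. *)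
Lemma Hinf_closure_of_B_closure (Z : (Cx -> Cx) -> Prop) (f : Cx -> Cx) :
  B_closure Z f -> Hinf_closure Z f.
Proof.
  intros H eps Heps. destruct (H eps Heps) as (y & Hy & df & a & b & _ & Ha & Hb & Hab).
  exists y. split; [easy|]. intros z Hz.
  apply B0_seminorm_nonneg in Hb. specialize (Ha z Hz). lra.
Qed.

Theorem mainTheorem6 :
  (forall Y : (Cx -> Cx) -> Prop,
     is_subspace Y -> shift_invariant Y -> (forall f, Y f -> in_B0 f) ->
     forall f, (in_B0 f /\ B_closure Y f) <-> (in_B0 f /\ Hinf_closure Y f)) /\
  (forall Z : (Cx -> Cx) -> Prop,
     is_subspace Z -> shift_invariant Z -> (forall f, Z f -> in_B f) ->
     (forall c : Cx, Z (fun _ => c)) ->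
     forall f, (in_B f /\ B_closure Z f) <-> (in_B f /\ Hinf_closure Z f)).
Proof.
  split.
  - intros Y HY Hshift HB f.
    split; intros [Hf Hcl]; (split; [exact Hf|]); [now apply Hinf_closure_of_B_closure|].
    apply B_closure_of_Hinf_closure with C0; try easy.
    + intros y Hy. now apply HB.
    + apply HY.
    + apply Hf.
    + intros eps Heps. destruct Hf as [_ Hv]. destruct (Hv eps Heps) as [X HX].
      exists X. intros x y Hx. specialize (HX (x, y) Hx). rewrite Defs_Cmod in HX.
      replace (f (x, y) - C0)%C with (f (x, y)); [exact HX|].
      apply injective_projections; simpl; ring.
  - intros Z HZ Hshift HB Hconst f.
    split; intros [Hf Hcl]; (split; [exact Hf|]); [now apply Hinf_closure_of_B_closure|].
    destruct Hf as (df & Hf & b & Hb).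
    (* The constant to be added to the difference of shifts is the limit of [f], whose existence
       comes from the finite seminorm. *)
    destruct (B_tends_at_infty f df b (proj1 (is_deriv_on_Cplus_iff f df) Hf) Hb) as [l Hl].
    apply B_closure_of_Hinf_closure with l; try easy.
    exists df. split; [exact Hf|]. now exists b.
Qed.
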